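(* Let $k\ge 2$, let $F=F(A)$ be a free group of rank $k$ with free basis $A=\{a_1,\dots,a_k\}$, and let $\alpha:F\to\mathbb{Z}^k$ be the abelianization homomorphism, $\alpha(a_i)=e_i$. Let $S\subseteq\mathbb{Z}^k$ be an $SL(k,\mathbb{Z})$-invariant subset and put $\widetilde{S}=\alpha^{-1}(S)\subseteq F$. Then: (1) For every $1\le p\le\infty$ the strict asymptotic density $\rho_p(S)$ exists and, moreover, for every $1\le p\le\infty$ we have $\rho_p(S)=\rho_\infty(S)$. (2) The strict annular density $\sigma_A(\widetilde{S})$ exists and, moreover, $\sigma_A(\widetilde{S})=\rho_\infty(S)$. That is, $$\lim_{n\to\infty}\frac12\left(\frac{\gamma_A(n-1,\{w\in F:\alpha(w)\in S\})}{\gamma_A(n-1,F)}+\frac{\gamma_A(n,\{w\in F:\alpha(w)\in S\})}{\gamma_A(n,F)}\right)=\lim_{n\to\infty}\frac{\#\{z\in\mathbb{Z}^k:\|z\|_\infty\le n,\ z\in S\}}{\#\{z\in\mathbb{Z}^k:\|z\|_\infty\le n\}}.$$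
   Context: For $w\in F$, $|w|_A$ denotes the freely reduced length of $w$ with respect to $A$. For $X\subseteq F$ and an integer $n\ge 0$, $\gamma_A(n,X)=\#\{w\in X:|w|_A=n\}$. The strict annular density of $X\subseteq F$ is $$\sigma_A(X)=\lim_{n\to\infty}\frac12\left(\frac{\gamma_A(n-1,X)}{\gamma_A(n-1,F)}+\frac{\gamma_A(n,X)}{\gamma_A(n,F)}\right),$$ provided this limit exists. For $1\le p\le\infty$ and $S\subseteq\mathbb{Z}^k$, the strict asymptotic density of $S$ with respect to the norm $\|\cdot\|_p$ is $$\rho_p(S)=\lim_{n\to\infty}\frac{\#\{z\in S:\|z\|_p\le n\}}{\#\{z\in\mathbb{Z}^k:\|z\|_p\le n\}},$$ provided this limit exists. $SL(k,\mathbb{Z})$ acts on $\mathbb{Z}^k$ in the natural linear way; $e_1,\dots,e_k$ is the standard basis of $\mathbb{Z}^k$. *)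

(* Defs.v *)
From mathcomp Require Import all_boot all_order all_algebra.
From mathcomp Require Import finmap.
From mathcomp Require Import all_classical all_reals all_analysis.

Set Implicit Arguments.
Unset Strict Implicit.
Unset Printing Implicit Defensive.

Import Order.TTheory GRing.Theory Num.Theory.
Import numFieldNormedType.Exports.

Local Open Scope classical_set_scope.
Local Open Scope ring_scope.

(* The universal property of a free group on the family [a]. *)
Definition free_basis (k : nat) (F : groupType) (a : 'I_k -> F) : Prop :=
  forall (G : groupType) (f : 'I_k -> G),
    exists phi : F -> G,
      [/\ {morph phi : x y / (x * y)%g},
          forall i, phi (a i) = f i
        & forall psi : F -> G,
            {morph psi : x y / (x * y)%g} ->
            (forall i, psi (a i) = f i) -> psi =1 phi].

(* The letter [(i, false)] stands for a_i and [(i, true)] for its inverse. *)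
Definition letter (k : nat) : Type := ('I_k * bool)%type.

Definition freely_reduced (k : nat) (s : seq (letter k)) : bool :=
  sorted (fun x y => ~~ ((x.1 == y.1) && (x.2 != y.2))) s.

Definition word_value (k : nat) (F : groupType) (a : 'I_k -> F)
    (s : seq (letter k)) : F :=
  (\prod_(x <- s) (if x.2 then (a x.1)^-1 else a x.1))%g.

(* When [a] is a free basis, exactly one freely reduced word represents [w],
   so the choice made by [xget] is forced and the default is never used. *)
Definition word_length (k : nat) (F : groupType) (a : 'I_k -> F) (w : F) : nat :=
  size (xget [::] [set s : seq (letter k) |
                    freely_reduced s /\ word_value a s = w]).

(* [fset_set] sends infinite sets to the empty set; [ncard] is only applied
   below to spheres and balls, which are finite. *)
Definition ncard (T : choiceType) (A : set T) : nat := #|` fset_set A|.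

Definition gamma (k : nat) (F : groupType) (a : 'I_k -> F)
    (n : nat) (X : set F) : nat :=
  ncard [set w | X w /\ word_length a w = n].

(* The term [n = 0], where [n.-1 = 0], does not affect the limit. *)
Definition annular_ratio (R : realType) (k : nat) (F : groupType)
    (a : 'I_k -> F) (X : set F) : R^nat := fun n =>
  2^-1 * ((gamma a n.-1 X)%:R / (gamma a n.-1 setT)%:R
          + (gamma a n X)%:R / (gamma a n setT)%:R).

(* The value at [-oo] is irrelevant: only [1 <= p] is used. *)
Definition lp_norm (R : realType) (k : nat) (p : \bar R) (z : 'cV[int]_k) : R :=
  match p with
  | r%:E => (\sum_(i < k) `|(z i 0)%:~R| `^ r) `^ r^-1
  | +oo%E => \big[Num.max/0]_(i < k) `|(z i 0)%:~R|
  | -oo%E => 0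
  end.

Definition ball_ratio (R : realType) (k : nat) (p : \bar R)
    (S : set 'cV[int]_k) : R^nat := fun n =>
  (ncard [set z | S z /\ lp_norm p z <= n%:R])%:R
  / (ncard [set z : 'cV[int]_k | lp_norm p z <= n%:R])%:R.

(* The two densities are meaningful only when the sequences converge. *)
Definition strict_annular_density (R : realType) (k : nat) (F : groupType)
    (a : 'I_k -> F) (X : set F) : R :=
  limn (annular_ratio R a X).

Definition strict_asymptotic_density (R : realType) (k : nat) (p : \bar R)
    (S : set 'cV[int]_k) : R :=
  limn (ball_ratio p S).

Definition SL_invariant (k : nat) (S : set 'cV[int]_k) : Prop :=
  forall M : 'M[int]_k, \det M = 1 -> [set M *m z | z in S] = S.

(* Main.v *)
(* An SL(k,Z)-invariant set is a union of level sets of the content (the gcd of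
   the coordinates), so that up to vectors of content 0 or at least M it is
   periodic modulo M!. Hence any sequence of averages on Z^k that is asymptotically
   equidistributed modulo every N, and gives little mass to vectors of content 0 or
   at least M uniformly as M grows, gives the set one and the same limit mass.

   For l_p balls both properties are lattice point counts, a ball being left only
   once along each line parallel to a coordinate axis.

   For spheres of F, cut a reduced word into blocks of three letters. Exchanging
   two letters u and v in the middle of a block keeps the word reduced when the
   outer letters of the block are not inverse to u or v, so the abelianized word
   follows a mixture of binomial laws in the direction u - v. Outside a set of
   words of proportion O(1/n) there are linearly many such blocks, so the law
   changes by O(n^(-1/2)) in total variation under translation by u - v. This
   gives equidistribution modulo N within each parity class, and two consecutive
   spheres carry both classes. It also bounds the proportion of words whose
   i-th and j-th coordinates are divisible by d by O(d^-2) for d = O(n^(1/2)),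
   while a second moment bound disposes of larger contents. *)

Require Import Defs.
From HB Require Import structures.
From mathcomp Require Import all_boot all_order all_algebra.
From mathcomp Require Import perm finmap zify ring lra.
From mathcomp Require Import all_classical all_reals all_analysis.

Set Implicit Arguments.
Unset Strict Implicit.
Unset Printing Implicit Defensive.

Import Order.TTheory GRing.Theory Num.Theory.
Import numFieldNormedType.Exports.

Local Open Scope classical_set_scope.
Local Open Scope ring_scope.

(** * Reduced words in a free group *)

(** Permutations of a possibly infinite type, with an explicit inverse, so that they form a
    [groupType] to which the universal property applies. *)
Record bijection (T : Type) := Bijection {
  bij_fun : T -> T;
  bij_inv : T -> T;
  bij_funK : cancel bij_fun bij_inv;
  bij_invK : cancel bij_inv bij_fun
}.

HB.instance Definition _ (T : Type) := gen_eqMixin (bijection T).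
HB.instance Definition _ (T : Type) := gen_choiceMixin (bijection T).

Section BijectionGroup.
Variable T : Type.
Implicit Types f g h : bijection T.

Lemma bijection_eq f g :
  bij_fun f = bij_fun g -> bij_inv f = bij_inv g -> f = g.
Proof.
case: f g => [f f' fK f'K] [g g' gK g'K] /= efg efg'.
rewrite -{}efg in gK g'K *; rewrite -{}efg' in gK g'K *.
by rewrite (Prop_irrelevance fK gK) (Prop_irrelevance f'K g'K).
Qed.

Definition bij_id : bijection T := @Bijection T id id (frefl id) (frefl id).

Definition bij_comp f g : bijection T :=
  Bijection (can_comp (bij_funK f) (bij_funK g))
            (can_comp (bij_invK g) (bij_invK f)).

Definition bij_flip f : bijection T := Bijection (bij_invK f) (bij_funK f).

Lemma bij_compA : associative bij_comp.
Proof. by move=> f g h; exact: bijection_eq. Qed.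

Lemma bij_comp1f : left_id bij_id bij_comp.
Proof. by move=> f; exact: bijection_eq. Qed.

Lemma bij_compf1 : right_id bij_id bij_comp.
Proof. by move=> f; exact: bijection_eq. Qed.

Lemma bij_compVf : left_inverse bij_id bij_flip bij_comp.
Proof.
by move=> f; apply: bijection_eq; apply/funext => x /=; rewrite bij_funK.
Qed.

Lemma bij_compfV : right_inverse bij_id bij_flip bij_comp.
Proof.
by move=> f; apply: bijection_eq; apply/funext => x /=; rewrite bij_invK.
Qed.

HB.instance Definition _ := isGroup.Build (bijection T)
  bij_compA bij_comp1f bij_compf1 bij_compVf bij_compfV.

End BijectionGroup.

Section Letters.
Variable k : nat.
Implicit Types (x y : letter k) (s : seq (letter k)).

Definition linv x : letter k := (x.1, ~~ x.2).

Definition follows : rel (letter k) := fun x y => y != linv x.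

Lemma linvK : involutive linv.
Proof. by case=> i b; rewrite /linv /= negbK. Qed.

Lemma linv_eq x y : (linv x == y) = (x == linv y).
Proof. exact: inv_eq linvK x y. Qed.

Lemma followsE x y : follows x y = ~~ ((x.1 == y.1) && (x.2 != y.2)).
Proof.
rewrite /follows; congr (~~ _).
case: x y => [i b] [j c]; rewrite xpair_eqE /= eq_sym; congr (_ && _).
by case: b c => [] [].
Qed.

Lemma freely_reducedE s : freely_reduced s = sorted follows s.
Proof.
rewrite /freely_reduced; case: s => //= x s.
by apply: eq_path => y z; rewrite followsE.
Qed.

(** Left multiplication by a letter, performing the only cancellation possible in front of a reduced
    word. *)
Definition lact x s : seq (letter k) :=
  if s is y :: s' then if y == linv x then s' else x :: s else [:: x].

Lemma lact_follows x s : path follows x s -> lact x s = x :: s.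
Proof. by case: s => //= y s /andP[/negbTE ->]. Qed.

Lemma lact_reduced x s : sorted follows s -> sorted follows (lact x s).
Proof.
case: s => //= y s; case: eqVneq => [_|nyx] ys; first exact: path_sorted ys.
by rewrite /= ys andbT.
Qed.

Lemma lactK x s : sorted follows s -> lact (linv x) (lact x s) = s.
Proof.
case: s => [|y s] /=; first by rewrite linvK eqxx.
case: eqVneq => [->|_ _] /=; last by rewrite linvK eqxx.
exact: lact_follows.
Qed.

Definition rword : Type := {s | sorted follows s}.

HB.instance Definition _ := [isSub for @sval _ (sorted follows) : rword -> _].

Definition rword_act x (s : rword) : rword :=
  exist _ (lact x (sval s)) (lact_reduced x (svalP s)).

Lemma rword_actK x : cancel (rword_act x) (rword_act (linv x)).
Proof. by move=> s; apply: val_inj; rewrite /= lactK//; exact: (svalP s). Qed.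

Lemma rword_actVK x : cancel (rword_act (linv x)) (rword_act x).
Proof. by move=> s; rewrite -{1}[x]linvK rword_actK. Qed.

Definition letter_bij x : bijection rword :=
  Bijection (rword_actK x) (rword_actVK x).

End Letters.

Section FreeGroup.
Variables (k : nat) (F : groupType) (a : 'I_k -> F).
Hypothesis ha : free_basis a.
Implicit Types (s t : seq (letter k)) (w : F).

Let lval (x : letter k) : F := if x.2 then (a x.1)^-1%g else a x.1.

Lemma word_value_cons x s : word_value a (x :: s) = (lval x * word_value a s)%g.
Proof. by rewrite /word_value big_cons. Qed.

Lemma lval_linv x : lval (linv x) = (lval x)^-1%g.
Proof. by case: x => i [] //=; rewrite /lval /= invgK. Qed.

Lemma word_value_lact x s : word_value a (lact x s) = (lval x * word_value a s)%g.
Proof.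
case: s => [|y s] /=; first by rewrite word_value_cons.
case: eqVneq => [->|_]; rewrite !word_value_cons//.
by rewrite lval_linv mulVKg.
Qed.

(* van der Waerden's trick: the bijection attached to the value of a reduced
   word sends the empty word to that word. *)
Lemma word_value_inj s t : freely_reduced s -> freely_reduced t ->
  word_value a s = word_value a t -> s = t.
Proof.
have [phi [phiM phia _]] := ha (fun i => letter_bij (i, false)).
have phi1 : phi 1%g = 1%g.
  by apply: (@mulgI _ (phi 1%g)); rewrite -phiM !mulg1.
have phiV w : phi w^-1%g = (phi w)^-1%g.
  by apply: (@mulgI _ (phi w)); rewrite -phiM !mulgV phi1.
have phil x : phi (lval x) = letter_bij x.
  case: x => i [] /=; rewrite /lval /= ?phiV phia //.
  by apply: bijection_eq.
pose e : rword k := exist _ [::] isT.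
have phis u : sorted (@follows k) u -> val (bij_fun (phi (word_value a u)) e) = u.
  elim: u => [|x u IHu] xu; first by rewrite /word_value big_nil phi1.
  rewrite word_value_cons phiM phil /= IHu; last exact: path_sorted xu.
  exact: lact_follows.
by rewrite !freely_reducedE => /phis {2}<- /phis {2}<- ->.
Qed.

Definition is_word_value : pred F := fun w => `[< exists s, word_value a s = w >].

Lemma word_value_cat s t :
  word_value a (s ++ t) = (word_value a s * word_value a t)%g.
Proof. by rewrite /word_value big_cat. Qed.

Lemma word_value_rev_linv s :
  word_value a (rev (map (@linv k) s)) = (word_value a s)^-1%g.
Proof.
elim: s => [|x s IHs]; first by rewrite /word_value !big_nil invg1.
rewrite /= rev_cons -cats1 word_value_cat IHs !word_value_cons invgM.
by rewrite lval_linv {2}/word_value big_nil mulg1.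
Qed.

Lemma is_word_value_closed : group_closed is_word_value.
Proof.
split=> [|_ _ /asboolP[s <-] /asboolP[t <-]].
  by apply/asboolP; exists [::]; rewrite /word_value big_nil.
apply/asboolP; exists (s ++ rev (map (@linv k) t)).
by rewrite word_value_cat word_value_rev_linv.
Qed.

Definition word_subgroup : Type := {w | is_word_value w}.

HB.instance Definition _ := [isSub for @sval F is_word_value : word_subgroup -> F].
HB.instance Definition _ := [Choice of word_subgroup by <:].
HB.instance Definition _ :=
  SubChoice_isSubGroup.Build F is_word_value word_subgroup is_word_value_closed.

(* The map of the universal property into the subgroup generated by the basis,
   followed by the inclusion, is the identity. *)
Lemma word_value_surj w : exists s, word_value a s = w.
Proof.
have aP i : is_word_value (a i).
  by apply/asboolP; exists [:: (i, false)]; rewrite /word_value big_seq1.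
pose b i : word_subgroup := exist _ (a i) (aP i).
have [phi [phiM phib _]] := ha b.
have [psi [_ _ psiU]] := ha a.
have e1 : (fun w => val (phi w)) =1 psi.
  by apply: psiU => [x y|i]; rewrite ?phiM ?phib.
have e2 : id =1 psi by exact: psiU.
by have /asboolP := valP (phi w); rewrite [val _]e1 -e2.
Qed.

Lemma reduced_word_value_surj w :
  exists2 s, freely_reduced s & word_value a s = w.
Proof.
have [s <-] := word_value_surj w; elim: s => [|x s [t tred tval]].
  by exists [::].
exists (lact x t); last by rewrite word_value_lact tval word_value_cons.
by rewrite freely_reducedE lact_reduced // -freely_reducedE.
Qed.

Lemma word_length_value s : freely_reduced s ->
  word_length a (word_value a s) = size s.
Proof.
move=> sred; rewrite /word_length; case: xgetP => [t _ [tred /esym e]|/(_ s)[]//].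
by rewrite (word_value_inj sred tred e).
Qed.

End FreeGroup.

(** * Means and periodic functions *)

Section Means.
Variables (R : realType) (V : zmodType).
Implicit Types (g h : V -> R) (d z : V) (E : (V -> R) -> R).
Implicit Types (m : nat -> (V -> R) -> R).

(** Averages over balls, over spheres and over pairs of consecutive spheres are treated alike as
    positive normalised linear functionals. *)
Definition mean E :=
  [/\ forall c g h, E (fun z => c * g z + h z) = c * E g + E h,
      forall g, (forall z, 0 <= g z) -> 0 <= E g
    & E (fun=> 1) = 1].

Section MeanTheory.
Variable E : (V -> R) -> R.
Hypothesis meanE : mean E.

Lemma meanD g h : E (fun z => g z + h z) = E g + E h.
Proof.
have [lin _ _] := meanE; rewrite -[E g]mul1r -lin; congr E.
by apply/funext => z; rewrite mul1r.
Qed.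

Lemma mean0 : E (fun=> 0) = 0.
Proof.
have := meanD (fun=> 0) (fun=> 0); rewrite addr0 => /eqP.
by rewrite -subr_eq0 opprD addrA subrr add0r oppr_eq0 => /eqP.
Qed.

Lemma meanZ c g : E (fun z => c * g z) = c * E g.
Proof.
have [lin _ _] := meanE; rewrite -[RHS]addr0 -mean0 -lin; congr E.
by apply/funext => z; rewrite addr0.
Qed.

Lemma mean_cst c : E (fun=> c) = c.
Proof.
have [_ _ one] := meanE; rewrite -[RHS]mulr1 -[in RHS]one -meanZ; congr E.
by apply/funext => z; rewrite mulr1.
Qed.

Lemma meanB g h : E (fun z => g z - h z) = E g - E h.
Proof.
rewrite -mulN1r -meanZ -meanD; congr E.
by apply/funext => z; rewrite mulN1r.
Qed.

Lemma mean_sum (I : Type) (r : seq I) (P : pred I) (G : I -> V -> R) :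
  E (fun z => \sum_(i <- r | P i) G i z) = \sum_(i <- r | P i) E (G i).
Proof.
elim: r => [|i r IHr].
  by rewrite big_nil -[RHS]mean0; congr E; apply/funext => z; rewrite big_nil.
rewrite big_cons; case: ifPn => Pi; rewrite -IHr -?meanD; congr E;
  by apply/funext => z; rewrite big_cons ?Pi// (negbTE Pi).
Qed.

Lemma mean_le g h : (forall z, g z <= h z) -> E g <= E h.
Proof.
move=> gh; rewrite -subr_ge0 -meanB; have [_ + _] := meanE.
by apply => z; rewrite subr_ge0.
Qed.

Lemma mean_norm g h : (forall z, `|g z| <= h z) -> `|E g| <= E h.
Proof.
move=> gh; rewrite ler_norml; apply/andP; split.
  rewrite -mulN1r -meanZ; apply: mean_le => z; rewrite mulN1r lerNl.
  by rewrite (le_trans (ler_norm _))// normrN.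
by apply: mean_le => z; rewrite (le_trans (ler_norm _)).
Qed.

End MeanTheory.

Definition average (s : seq V) g : R := (\sum_(z <- s) g z) / (size s)%:R.

Lemma mean_average (s : seq V) : (0 < size s)%N -> mean (average s).
Proof.
move=> s_gt0; have s0 : (size s)%:R != 0 :> R by rewrite pnatr_eq0 -lt0n.
rewrite /average; split=> [c g h|g g0|].
- by rewrite big_split /= -mulr_sumr mulrDl mulrA.
- by rewrite divr_ge0// sumr_ge0.
- by rewrite big_const_seq count_predT iter_addr_0 divff.
Qed.

Lemma mean_half E E' : mean E -> mean E' -> mean (fun g => 2^-1 * (E g + E' g)).
Proof.
move=> [lin ge0 one] [lin' ge0' one']; split=> [c g h|g g0|].
- by rewrite lin lin'; ring.
- by rewrite mulr_ge0// addr_ge0// ?ge0 ?ge0'.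
- by rewrite one one'; field.
Qed.

(** For large [M], [L M] is close to [m n s] for all large [n]. Comparing two values of [L] at a
    common [n] shows that [L] is Cauchy, and its limit then attracts [m n s]. *)
Lemma mean_limit m (s : V -> R) (f t : nat -> V -> R) (L : nat -> R) :
  (forall n, mean (m n)) ->
  (forall M z, `|s z - f M z| <= t M z) ->
  (forall M, (0 < M)%N -> m n (f M) @[n --> \oo] --> L M) ->
  (forall e, 0 < e -> \forall M \near \oo, \forall n \near \oo, m n (t M) <= e) ->
  m n s @[n --> \oo] --> limn L.
Proof.
move=> meanm sft fL tail.
have near e : 0 < e ->
    \forall M \near \oo, \forall n \near \oo, `|m n s - L M| <= e.
  move=> e0; have e2 : 0 < e / 2 by rewrite divr_gt0.
  have [M0 _ M0P] := tail _ e2.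
  exists M0.+1 => // M /= M0M.
  have M_gt0 : (0 < M)%N by exact: leq_trans M0M.
  have /cvgrPdist_le/(_ _ e2) := fL M M_gt0.
  apply: filterS2 (M0P M (ltnW M0M)) => n tn Ln.
  rewrite (splitr e) -[m n s](subrK (m n (f M))) -addrA.
  rewrite (le_trans (ler_normD _ _))// lerD//; last by rewrite distrC.
  by rewrite -meanB// (le_trans _ tn)// mean_norm.
have cvgL : cvgn L.
  apply/cauchy_cvgP/cauchy_exP => e e0.
  have e4 : 0 < e / 4 by rewrite divr_gt0.
  have [M0 _ M0P] := near _ e4.
  exists (L M0); exists M0 => // M /= M0M.
  have [n1 _ /(_ n1 (leqnn _))] : \forall n \near \oo,
      `|m n s - L M0| <= e / 4 /\ `|m n s - L M| <= e / 4.
    by apply: filterS2 (M0P M0 (leqnn _)) (M0P M M0M) => n.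
  move=> [+ +]; rewrite /ball /= !ler_norml ltr_norml => /andP[? ?] /andP[? ?].
  by apply/andP; split; lra.
apply/cvgrPdist_le => e e0.
have e2 : 0 < e / 2 by rewrite divr_gt0.
have /cvgrPdist_le/(_ _ e2) [M1 _ M1P] := cvgL.
have [M0 _ M0P] := near _ e2.
have := M0P (maxn M0 M1) (leq_maxl _ _).
have := M1P (maxn M0 M1) (leq_maxr _ _).
move=> LM; apply: filterS => n; move: LM.
by rewrite !ler_norml => /andP[? ?] /andP[? ?]; apply/andP; split; lra.
Qed.

Definition shift d g : V -> R := fun z => g (z + d).

Definition almost_invariant m d :=
  forall g, (forall z, `|g z| <= 1) -> m n g - m n (shift d g) @[n --> \oo] --> 0.

Definition periodic (N : nat) g := forall z d, g (z + d *+ N) = g z.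

(** On [N]-periodic functions with [N] positive, this is the projection onto the functions invariant
    under [d]. *)
Definition smear N d g : V -> R := fun z => N%:R^-1 * \sum_(j < N) g (z + d *+ j).

Definition smears N (ds : seq V) g : V -> R := foldr (smear N) g ds.

Lemma shift0 g : shift 0 g = g.
Proof. by apply/funext => z; rewrite /shift addr0. Qed.

Lemma shiftD d d' g : shift (d + d') g = shift d (shift d' g).
Proof. by apply/funext => z; rewrite /shift addrA. Qed.

Lemma smear_norm N d g : (forall z, `|g z| <= 1) -> forall z, `|smear N d g z| <= 1.
Proof.
move=> g1 z; have [->|N0] := posnP N.
  by rewrite /smear big_ord0 mulr0 normr0.
rewrite /smear normrM ger0_norm ?invr_ge0// ler_pdivrMl ?ltr0n// mulr1.
rewrite (le_trans (ler_norm_sum _ _ _))//.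
rewrite (le_trans (ler_sum _ (fun i _ => g1 _)))//.
by rewrite sumr_const card_ord.
Qed.

Lemma smear_periodic N N' d g : periodic N g -> periodic N (smear N' d g).
Proof.
move=> gN z d'; congr (_ * _); apply: eq_bigr => j _.
by rewrite addrAC gN.
Qed.

Lemma smear_invariant N d d' g : shift d' g = g -> shift d' (smear N d g) = smear N d g.
Proof.
move=> gd; apply/funext => z; congr (_ * _); apply: eq_bigr => j _.
by rewrite addrAC -[in RHS]gd.
Qed.

(** The shift drops the term [j = 0] and adds a term [j = N], equal to it by periodicity. *)
Lemma smear_shift N d g : periodic N g -> shift d (smear N d g) = smear N d g.
Proof.
move=> gN; apply/funext => z; rewrite /shift /smear; congr (_ * _).
case: N gN => [|N] gN; first by rewrite !big_ord0.
rewrite big_ord_recr [RHS]big_ord_recl /= mulr0n addr0 addrC.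
rewrite -addrA -mulrS gN; congr (_ + _); apply: eq_bigr => j _.
by rewrite -addrA -mulrS.
Qed.

Lemma smears_norm N ds g : (forall z, `|g z| <= 1) -> forall z, `|smears N ds g z| <= 1.
Proof. by move=> g1; elim: ds => //= d ds; exact: smear_norm. Qed.

Lemma smears_invariant N ds g d : periodic N g -> d \in ds ->
  shift d (smears N ds g) = smears N ds g.
Proof.
move=> gN; have pN es : periodic N (smears N es g).
  by elim: es => //= e es; exact: smear_periodic.
elim: ds => //= e ds IHds; rewrite inE => /predU1P[->|/IHds].
  exact: smear_shift.
exact: smear_invariant.
Qed.

Lemma almost_invariant0 m : almost_invariant m 0.
Proof. by move=> g _; rewrite shift0; under eq_fun do rewrite subrr; exact: cvg_cst. Qed.

Lemma almost_invariantD m d d' :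
  almost_invariant m d -> almost_invariant m d' -> almost_invariant m (d + d').
Proof.
move=> md md' g g1; rewrite shiftD -[0]addr0.
have -> : (fun n => m n g - m n (shift d (shift d' g))) =
   (fun n => (m n g - m n (shift d' g)) +
             (m n (shift d' g) - m n (shift d (shift d' g)))).
  by apply/funext => n; ring.
by apply: cvgD; [exact: md'|apply: md => z; exact: g1].
Qed.

Lemma almost_invariantMn m d j :
  almost_invariant m d -> almost_invariant m (d *+ j).
Proof.
move=> md; elim: j => [|j IHj]; first exact: almost_invariant0.
by rewrite mulrS; exact: almost_invariantD.
Qed.

(** The difference is an average of [N] differences between [g] and its translates by multiples of
    [d], and almost invariance passes to multiples. *)
Lemma mean_smear m N d g : (forall n, mean (m n)) -> (0 < N)%N ->
  almost_invariant m d -> (forall z, `|g z| <= 1) ->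
  m n g - m n (smear N d g) @[n --> \oo] --> 0.
Proof.
move=> meanm N0 md g1.
have NR : N%:R != 0 :> R by rewrite pnatr_eq0 -lt0n.
have -> : (fun n => m n g - m n (smear N d g)) =
   (fun n => N%:R^-1 * \sum_(j < N) (m n g - m n (shift (d *+ j) g))).
  apply/funext => n; rewrite meanZ// mean_sum// sumrB sumr_const card_ord.
  by rewrite mulrBr -[m n g *+ N]mulr_natl mulKf.
rewrite -[X in _ --> X](mulr0 N%:R^-1); apply: cvgMl_tmp.
elim: {N0 NR}N => [|N IHN].
  by under eq_fun do rewrite big_ord0; exact: cvg_cst.
rewrite -[X in _ --> X]addr0; under eq_fun do rewrite big_ord_recr /=.
by apply: cvgD => //; exact: almost_invariantMn.
Qed.

Lemma mean_smears m N ds g : (forall n, mean (m n)) -> (0 < N)%N ->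
  (forall d, d \in ds -> almost_invariant m d) -> (forall z, `|g z| <= 1) ->
  m n g - m n (smears N ds g) @[n --> \oo] --> 0.
Proof.
move=> meanm N0 + g1; elim: ds => [_|d ds IHds inv] /=.
  by under eq_fun do rewrite subrr; exact: cvg_cst.
have -> : (fun n => m n g - m n (smear N d (smears N ds g))) =
   (fun n => (m n g - m n (smears N ds g)) +
             (m n (smears N ds g) - m n (smear N d (smears N ds g)))).
  by apply/funext => n; ring.
rewrite -[0]addr0; apply: cvgD.
  by apply: IHds => e eds; apply: inv; rewrite inE eds orbT.
apply: mean_smear => //; last exact: smears_norm.
by apply: inv; rewrite mem_head.
Qed.

End Means.

(** * Content and SL-invariant sets *)

Section Lattice.
Variable k : nat.
Local Notation V := 'cV[int]_k.
Implicit Types z : V.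

Definition content z : nat := \big[gcdn/0%N]_(i < k) absz (z i 0).

Lemma dvdn_contentP d z :
  reflect (forall i, (d%:Z %| z i ord0)%Z) (d %| content z)%N.
Proof.
by apply: (iffP (dvdn_biggcdP _ _ _)) => dz i *; have := dz i; rewrite ?dvdzE; apply.
Qed.

Lemma content0 : content 0 = 0%N.
Proof. by apply/eqP; rewrite -dvd0n; apply/dvdn_contentP => i; rewrite mxE dvdz0. Qed.

Lemma content_eq0 z : content z = 0%N -> z = 0.
Proof.
move=> /eqP; rewrite -dvd0n => /dvdn_contentP z0.
apply/colP => i; rewrite mxE; apply/eqP; rewrite -absz_eq0 -dvd0n.
by have := z0 i; rewrite dvdzE.
Qed.

Lemma content_le z i : z i 0 != 0 -> (content z <= `|z i ord0|)%N.
Proof.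
rewrite -absz_gt0 => zi; apply: dvdn_leq => //.
by have /dvdn_contentP/(_ i) := dvdnn (content z); rewrite dvdzE.
Qed.

(** Both sides have the same divisors, since a divisor of [N] divides every coordinate of
    [d *+ N]. *)
Lemma gcdn_content_periodic N z d :
  gcdn N (content (z + d *+ N)) = gcdn N (content z).
Proof.
have dvd e z' :
      (e %| gcdn N (content (z' + d *+ N)))%N = (e %| gcdn N (content z'))%N.
  rewrite !dvdn_gcd; case eN: (e %| N)%N => //=.
  have dN i : (e%:Z %| (d *+ N) i ord0)%Z.
    by rewrite mulmxnE -mulr_natr dvdz_mull// natz dvdzE.
  by apply/dvdn_contentP/dvdn_contentP => ez i; have := ez i;
     rewrite !mxE ?rpredDr// dN.
by apply/eqP; rewrite eqn_dvd -dvd dvdnn dvd dvdnn.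
Qed.

Definition lvec (x : letter k) : V :=
  if x.2 then - delta_mx x.1 0 else delta_mx x.1 0.

Lemma lvec_linv x : lvec (linv x) = - lvec x.
Proof. by case: x => i []; rewrite /lvec /= ?opprK. Qed.

Definition lvec_sum (s : seq (letter k)) : V := \sum_(x <- s) lvec x.

Lemma lvec_sum_cons x s : lvec_sum (x :: s) = lvec x + lvec_sum s.
Proof. by rewrite /lvec_sum big_cons. Qed.

Lemma lvec_invariant_cst (T : Type) (h : V -> T) :
  (forall z x, h (z + lvec x) = h z) -> forall z, h z = h 0.
Proof.
move=> inv; have invn z x j : h (z + lvec x *+ j) = h z.
  by elim: j => [|j IHj]; rewrite ?addr0// mulrSr addrA inv.
have invz z i (c : int) : h (z + delta_mx i 0 *~ c) = h z.
  case: c => j; first exact: (invn z (i, false)).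
  by rewrite NegzE mulrNz -mulNrz; exact: (invn z (i, true)).
move=> z; have -> : z = \sum_i delta_mx i 0 *~ z i 0.
  rewrite [LHS]matrix_sum_delta; apply: eq_bigr => i _.
  by rewrite big_ord1 -scaler_int intz.
elim: (index_enum _) => [|i r IHr]; first by rewrite big_nil.
by rewrite big_cons addrC invz.
Qed.

End Lattice.

(** * Orbits of the special linear group on the lattice *)

Section Orbits.
Variable k : nat.
Local Notation V := 'cV[int]_k.+2.
Local Notation e0 := (delta_mx 0 0 : V).

(** The Smith normal form of the column [z] has this shape up to the signs of the determinant and of
    the scalar. *)
Lemma SL_orbit (z : V) :
  exists2 M : 'M[int]_k.+2, \det M = 1 & z = M *m ((content z)%:Z *: e0).
Proof.
suff [M [c [detM zE]]] : exists (M : 'M[int]_k.+2) (c : nat),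
    \det M = 1 /\ z = M *m (c%:Z *: e0).
  (* [M] and its inverse preserve common divisors of the coordinates, which forces [c] to be the
     content. *)
  exists M => //; suff -> : content z = c by [].
  have Mu : M \in unitmx by rewrite unitmxE detM unitr1.
  have dvdM (N : 'M[int]_k.+2) (y : V) d :
      (d %| content y)%N -> (d %| content (N *m y))%N.
    move=> /dvdn_contentP dy; apply/dvdn_contentP => i.
    by rewrite mxE; apply: rpred_sum => j _; apply: dvdz_mull.
  have ce : content (c%:Z *: e0) = c.
    apply/eqP; rewrite eqn_dvd; apply/andP; split.
      have /dvdn_contentP/(_ 0) := dvdnn (content (c%:Z *: e0)).
      by rewrite !mxE mulr1 dvdzE.
    by apply/dvdn_contentP => i; rewrite mxE dvdz_mulr.
  apply/eqP; rewrite eqn_dvd -{2}ce; apply/andP; split.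
    by rewrite -[X in (_ %| X)%N]ce -(mulKmx Mu (c%:Z *: e0)) -zE dvdM.
  by rewrite zE dvdM.
have [L Lu [Q Qu [d _ zE]]] := int_Smith_normal_form z.
pose c := d`_0 * Q 0 0.
have {zE} zE : z = L *m (c *: e0).
  rewrite zE (mx11_scalar Q) mul_mx_scalar scalemxAr; congr (_ *m _).
  apply/colP => i; rewrite !mxE /c eqxx andbT; have [->|] := eqVneq i 0.
    by rewrite mulr1n mulr1 mulrC.
  by case: i => -[|i] ? //= _; rewrite mulr0n !mulr0.
have [s s2 cE] : exists2 s : int, s * s = 1 & c = s * `|c|%N%:Z.
  have [c0|c0] := leP 0 c; first by exists 1; rewrite ?mul1r ?gez0_abs.
  by exists (- 1); rewrite ?mulrNN ?mulN1r ?mul1r// ltz0_abs// opprK.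
have L2 : \det L * \det L = 1.
  have : (\det L == 1) || (\det L == -1) by rewrite unitmxE in Lu.
  by case/orP => /eqP ->; rewrite ?mulrNN mulr1.
(* The entry at index 0 makes the scalar nonnegative; the one at index 1, available in dimension at
   least 2, brings the determinant back to 1. *)
pose D : 'rV[int]_k.+2 :=
  \row_i (if val i is j.+1 then if j is 0 then s * \det L else 1 else s).
exists (L *m diag_mx D), `|c|%N; split.
  rewrite det_mulmx det_diag !big_ord_recl big1 => [|i _]; last by rewrite mxE.
  transitivity (s * s * (\det L * \det L)); last by rewrite s2 L2 mulr1.
  by rewrite !mxE /=; ring.
rewrite zE -mulmxA; congr (_ *m _); rewrite mul_diag_mx.
apply/colP => i; rewrite !mxE {1}cE eqxx andbT; have [->|_] := eqVneq i 0.
  by rewrite /= !mulr1.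
by rewrite !mulr0.
Qed.

Lemma SL_invariant_content (S : set V) z : SL_invariant S ->
  S z <-> S ((content z)%:Z *: e0).
Proof.
move=> SL; have [M detM zE] := SL_orbit z; split=> [Sz|Sc].
  have [y Sy My] : [set M *m y | y in S] z by rewrite SL.
  have Mu : M \in unitmx by rewrite unitmxE detM unitr1.
  suff <- : y = (content z)%:Z *: e0 by [].
  by rewrite -[LHS](mulKmx Mu) My {1}zE mulKmx.
by rewrite zE -(SL M detM); exists ((content z)%:Z *: e0).
Qed.

End Orbits.

(** * Densities of invariant sets along a sequence of means *)

Section Density.
Variables (R : realType) (k : nat).
Local Notation V := 'cV[int]_k.+2.
Local Notation e0 := (delta_mx 0 0 : V).
Implicit Types (S : set V) (z : V) (h : V -> R) (m : nat -> (V -> R) -> R).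

Definition indicator S z : R := `[< S z >]%:R.

(* Agrees with the indicator of an SL-invariant [S] as soon as the content of
   [z] lies strictly between [0] and [M], but depends on [z] modulo [M`!] only. *)
Definition content_approx S M z : R :=
  `[< S ((gcdn M`! (content z))%:Z *: e0) >]%:R.

Definition bad_content M z : R := (~~ (0 < content z < M)%N)%:R.

Lemma norm_bool (b : bool) : `|b%:R : R| <= 1.
Proof. by rewrite normr_nat lern1; case: b. Qed.

Lemma indicator_approx S M z : SL_invariant S ->
  `|indicator S z - content_approx S M z| <= bad_content M z.
Proof.
move=> SL; rewrite /indicator /content_approx /bad_content.
case: (boolP (0 < content z < M)%N) => [/andP[c0 cM]|_]; last first.
  by do 2![case: `[< _ >]];
    rewrite /= ?mulr1n ?mulr0n ?subrr ?subr0 ?sub0r ?normrN ?normr1 ?normr0.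
rewrite (eqP (_ : gcdn M`! (content z) == content z)); last first.
  by apply/eqP/gcdn_idPr; apply: dvdn_fact; rewrite c0 ltnW.
have -> : `[< S z >] = `[< S ((content z)%:Z *: e0) >].
  by apply: asbool_equiv_eq; exact: SL_invariant_content.
by rewrite subrr normr0.
Qed.

Lemma content_approx_periodic S M : periodic M`! (content_approx S M).
Proof. by move=> z d; rewrite /content_approx gcdn_content_periodic. Qed.

(** These generate the vectors of even coordinate sum. On spheres one cannot ask for more
    invariance, since the length of a word fixes the parity of its image. *)
Definition letter_diffs : seq V :=
  [seq lvec x - lvec y | x <- enum {: 'I_k.+2 * bool}, y <- enum {: 'I_k.+2 * bool}].

Lemma mem_letter_diffs x y : lvec x - lvec y \in letter_diffs.
Proof. by apply/allpairsP; exists (x, y); rewrite !mem_enum. Qed.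

(* Averaging [g] over the translations by differences of letters makes it a
   function of the parity of the sum of the coordinates. *)
Definition periodic_mean N (g : V -> R) : R :=
  2^-1 * (smears N letter_diffs g 0 + smears N letter_diffs g e0).

Definition parity_function h := forall z x y, h (z + lvec x) = h (z + lvec y).

Lemma parity_smears N g : periodic N g -> parity_function (smears N letter_diffs g).
Proof.
move=> gN z x y; rewrite -[in RHS](smears_invariant gN (mem_letter_diffs x y)).
by congr (smears _ _ _ _); rewrite -addrA [lvec y + _]addrC subrK.
Qed.

Lemma parity_function2 h z x y : parity_function h -> h (z + lvec x + lvec y) = h z.
Proof. by move=> hp; rewrite (hp _ y (linv x)) lvec_linv addrK. Qed.

(** Smearing turns [g] into a parity function [h]. The sum of [h] and its translate by [e0] is
    constant, and the two summands have asymptotically equal means. *)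
Lemma periodic_mean_cvg m N g : (forall n, mean (m n)) -> (0 < N)%N ->
  (forall x, almost_invariant m (lvec x)) ->
  periodic N g -> (forall z, `|g z| <= 1) ->
  m n g @[n --> \oo] --> periodic_mean N g.
Proof.
move=> meanm N0 inv gN g1; pose h := smears N letter_diffs g.
have hp : parity_function h by exact: parity_smears.
have mh : m n g - m n h @[n --> \oo] --> 0.
  apply: mean_smears => // _ /allpairsP[[x y] /= [_ _ ->]].
  by rewrite -lvec_linv; exact: almost_invariantD.
have mh0 : m n h - m n (shift e0 h) @[n --> \oo] --> 0.
  by apply: (inv (0, false)) => z; exact: smears_norm.
have hE z : h z + shift e0 h z = h 0 + h e0.
  rewrite -[in RHS](add0r e0); move: z; apply: lvec_invariant_cst => z x.
  rewrite /shift (hp z x (0, false)) addrC; congr (_ + _).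
  exact: (@parity_function2 _ _ _ (0, false)).
suff -> : (fun n => m n g) = (fun n => (m n g - m n h) +
    2^-1 * (m n h - m n (shift e0 h)) + periodic_mean N g).
  rewrite -[X in _ --> X]add0r -[X in _ --> X + _]addr0 -[X in _ --> _ + X + _](mulr0 2^-1).
  by apply: cvgD; [apply: cvgD => //; exact: cvgMl_tmp|exact: cvg_cst].
apply/funext => n; rewrite /periodic_mean -/h.
have -> : h 0 + h e0 = m n h + m n (shift e0 h).
  rewrite -meanD// -[LHS](mean_cst (meanm n)); congr (m n _).
  by apply/funext => z; rewrite hE.
by field.
Qed.

(** The limit is written without [m], which is what later identifies the densities with one
    another. *)
Lemma SL_density m S : SL_invariant S -> (forall n, mean (m n)) ->
  (forall N g, (0 < N)%N -> periodic N g -> (forall z, `|g z| <= 1) ->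
    m n g @[n --> \oo] --> periodic_mean N g) ->
  (forall e, 0 < e -> \forall M \near \oo, \forall n \near \oo,
    m n (bad_content M) <= e) ->
  m n (indicator S) @[n --> \oo]
    --> limn (fun M => periodic_mean M`! (content_approx S M)).
Proof.
move=> SL meanm perm; apply: (@mean_limit _ _ _ _ (content_approx S)) => //.
  by move=> M z; exact: indicator_approx.
move=> M M0; apply: perm; first exact: fact_gt0.
  exact: content_approx_periodic.
by move=> z; exact: norm_bool.
Qed.

End Density.

(** * Balls *)

(** Each term is at most the telescoping difference [2 / d - 2 / (d + 1)]. *)
Lemma sum_inv_sqr_le (R : realType) (M D : nat) : (0 < M <= D)%N ->
  \sum_(M <= d < D) (d%:R ^- 2 : R) <= 2 / M%:R.
Proof.
move=> /andP[M0 MD]; suff : \sum_(M <= d < D) (d%:R ^- 2 : R) <= 2 / M%:R - 2 / D%:R.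
  by move=> /le_trans; apply; rewrite gerBl divr_ge0.
elim: D MD => [|D IHD]; first by rewrite leqn0 => /eqP ->; rewrite big_geq// subrr.
rewrite leq_eqVlt => /predU1P[->|]; first by rewrite big_geq// subrr.
rewrite ltnS => MD; rewrite big_nat_recr//=.
have D1 : 1 <= D%:R :> R by rewrite ler1n (leq_trans M0).
rewrite -[D.+1%:R]natr1; set x := D%:R in D1 IHD *.
have x0 : 0 < x by rewrite (lt_le_trans _ D1).
have step : x ^- 2 <= 2 / x - 2 / (x + 1).
  have -> : 2 / x - 2 / (x + 1) = 2 / (x * (x + 1)).
    by field; rewrite !gt_eqF//; lra.
  have -> : 2 / (x * (x + 1)) = (x * (x + 1) / 2)^-1.
    by field; rewrite !gt_eqF//; lra.
  rewrite lef_pV2 ?posrE ?exprn_gt0 ?divr_gt0 ?mulr_gt0//; last by lra.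
  by rewrite ler_pdivrMr//; nra.
by have := IHD MD; lra.
Qed.

Lemma average_le (R : realType) (V : choiceType) (s : seq V) (g h : V -> R) :
  (forall z, z \in s -> g z <= h z) ->
  (\sum_(z <- s) g z) / (size s)%:R <= (\sum_(z <- s) h z) / (size s)%:R.
Proof. by move=> gh; rewrite ler_wpM2r ?invr_ge0// big_seq [leRHS]big_seq ler_sum. Qed.

Lemma sum_pred_natr (R : pzSemiRingType) (T : Type) (s : seq T) (p : pred T) :
  \sum_(z <- s) (p z)%:R = (count p s)%:R :> R.
Proof.
rewrite -sum1_count natr_sum [RHS]big_mkcond.
by apply: eq_bigr => z _; case: (p z).
Qed.

Section Cube.
Variable k : nat.
Local Notation V := 'cV[int]_k.
Implicit Types (y z : V) (n : nat).

Definition cube n : seq V :=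
  [seq \col_i ((A i 0 : nat)%:Z - n%:Z)
   | A : 'cV['I_(n.*2.+1)]_k <- enum {: 'cV['I_(n.*2.+1)]_k}].

Lemma size_cube n : size (cube n) = (n.*2.+1 ^ k)%N.
Proof. by rewrite size_map -cardE card_mx card_ord muln1. Qed.

Lemma cube_uniq n : uniq (cube n).
Proof.
rewrite map_inj_uniq ?enum_uniq// => A B /colP AB; apply/colP => i.
by have := AB i; rewrite !mxE => /addIr [] /ord_inj.
Qed.

Lemma mem_cube n z : reflect (forall i, (`|z i ord0| <= n)%N) (z \in cube n).
Proof.
apply: (iffP mapP) => [[A _ ->] i|zn].
  rewrite mxE; case: (A i 0) => j /= jn. lia.
exists (\col_i inord (absz (z i ord0 + n%:Z))); rewrite ?mem_enum//.
apply/colP => i; rewrite !mxE; have := zn i; move: (z i ord0) => c cn.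
by rewrite inordK; lia.
Qed.

Lemma cube_multiples n d z : (0 < d)%N -> (d %| content z)%N -> z \in cube n ->
  z \in [seq d%:Z *: w | w <- cube (n %/ d)].
Proof.
move=> d0 /dvdn_contentP dz /mem_cube zn; apply/mapP.
exists (\col_i (z i ord0 %/ d)%Z).
  apply/mem_cube => i; rewrite mxE leq_divRL//.
  have := zn i; rewrite -{1}(divzK (dz i)) abszM.
  by apply: leq_trans; rewrite leqnn.
by apply/colP => i; rewrite !mxE mulrC divzK.
Qed.

End Cube.

Lemma near_div_le (R : realType) (C e : R) : 0 < e ->
  \forall n \near \oo, C / n%:R <= e.
Proof.
move=> e0; apply: filterS2 (nbhs_infty_gt 0) (nbhs_infty_ger (C / e)) => n n0.
by rewrite !ler_pdivrMr ?ltr0n// mulrC.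
Qed.

(** * Lattice points in solid balls *)

Section SolidBalls.
Variables (R : realType) (k : nat) (P : nat -> pred 'cV[int]_k.+2).
Local Notation V := 'cV[int]_k.+2.
Local Notation K := k.+2.
Implicit Types (y z : V) (n : nat) (x : letter k.+2).

(** An l_p ball enters only through three properties: it is stable under shrinking coordinates, it
    lies in the cube of radius [n], and it contains the cube of radius [n / K]. The factor [K] is
    the worst case, [p = 1]. *)
Hypothesis solid : forall n y z,
  (forall i, `|y i ord0| <= `|z i ord0|)%N -> P n z -> P n y.
Hypothesis P_cube : forall n z, P n z -> forall i, (`|z i ord0| <= n)%N.
Hypothesis cube_P : forall n z, (forall i, (`|z i ord0| * K <= n)%N) -> P n z.

Definition ball_seq n := [seq z <- cube K n | P n z].

Lemma mem_ball_seq n z : (z \in ball_seq n) = P n z.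
Proof.
by rewrite mem_filter andb_idr// => Pz; apply/mem_cube; exact: P_cube.
Qed.

Lemma ball_seq_uniq n : uniq (ball_seq n).
Proof. by rewrite filter_uniq// cube_uniq. Qed.

Lemma size_ball_seq n : (n ^ K <= K ^ K * size (ball_seq n))%N.
Proof.
apply: (@leq_trans (K ^ K * size (cube K (n %/ K)))).
  rewrite size_cube -expnMn leq_exp2r//.
  rewrite {1}(divn_eq n K) [leqRHS]mulnS addnC leq_add ?(ltnW (ltn_pmod _ _))//.
  by rewrite mulnC leq_mul2l -addnn leq_addr orbT.
rewrite leq_mul2l; apply/orP; right; apply: uniq_leq_size; first exact: cube_uniq.
move=> z /mem_cube zn; rewrite mem_ball_seq; apply: cube_P => i.
by rewrite -leq_divRL.
Qed.

Lemma size_ball_seq_gt0 n : (0 < size (ball_seq n))%N.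
Proof.
have : 0 \in ball_seq n by rewrite mem_ball_seq; apply: cube_P => i; rewrite mxE.
by case: (ball_seq n).
Qed.

Definition exit_seq n x := [seq z <- ball_seq n | ~~ P n (z + lvec x)].

Lemma lvecE x i : lvec x i ord0 = (if i == x.1 then (-1) ^+ x.2 else 0) :> int.
Proof. by case: x => j []; rewrite /lvec !mxE /= eqxx andbT; case: eqP. Qed.

(** If [z] were strictly beyond [y] on their common line, the step from [y] would either approach
    the origin or not go past [z]; by solidity it would stay in the ball. *)
Lemma exit_seq_lt n x y z : y \in exit_seq n x -> P n z ->
  (forall i, i != x.1 -> y i ord0 = z i ord0) ->
  (-1) ^+ x.2 * z x.1 ord0 <= (-1) ^+ x.2 * y x.1 ord0.
Proof.
rewrite mem_filter mem_ball_seq => /andP[nP Py] Pz yz; rewrite leNgt.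
apply: contra nP => lt_yz.
have [neg|pos] := ltP ((-1) ^+ x.2 * y x.1 ord0) 0.
  apply: (@solid n _ y) => // i; rewrite mxE lvecE.
  case: eqVneq => [->|_]; last by rewrite addr0.
  by case: (x.2) neg => /=; rewrite ?expr0 ?expr1 ?mul1r ?mulN1r; lia.
apply: (@solid n _ z) => // i; rewrite mxE lvecE.
case: eqVneq => [->|/yz ->]; last by rewrite addr0.
by case: (x.2) pos lt_yz => /=; rewrite ?expr0 ?expr1 ?mul1r ?mulN1r; lia.
Qed.

(* A line parallel to [lvec x] leaves the ball only once in that direction. *)
Lemma size_exit_seq n x : (n.*2.+1 * size (exit_seq n x) <= n.*2.+1 ^ K)%N.
Proof.
(* The coordinate along the line takes each of its [2n+1] values in the cube. Distinct exit points
   lie on distinct lines, so all the resulting points are distinct. *)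
pose put z (j : 'I_n.*2.+1) : V :=
  \col_i if i == x.1 then (j : nat)%:Z - n%:Z else z i ord0.
rewrite -size_cube mulnC -[X in (_ * X <= _)%N]card_ord cardE -(size_allpairs put).
have sub : {subset [seq put z j | z <- exit_seq n x, j <- enum 'I_n.*2.+1] <= cube K n}.
  move=> _ /allpairsP[[z j] /= [+ _ ->]]; rewrite mem_filter mem_ball_seq.
  move=> /andP[_ Pz]; apply/mem_cube => i; rewrite mxE.
  by case: eqVneq => [_|_]; [have := ltn_ord j; lia|exact: P_cube].
apply: uniq_leq_size sub; apply: allpairs_uniq.
- by rewrite filter_uniq// ball_seq_uniq.
- exact: enum_uniq.
move=> _ _ /allpairsP[[z j] /= [zE _ ->]] /allpairsP[[y l] /= [yE _ ->]] /colP yz.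
have {}yz i : (put z j) i ord0 = (put y l) i ord0 by exact: yz.
have jl : j = l.
  by have := yz x.1; rewrite !mxE eqxx => /addIr [] /ord_inj.
have zy i : i != x.1 -> z i ord0 = y i ord0.
  by move=> ix; have := yz i; rewrite !mxE (negbTE ix).
have Pe t : t \in exit_seq n x -> P n t.
  by rewrite mem_filter mem_ball_seq => /andP[].
congr (_, _) => //; apply/colP => i; have [->|/zy//] := eqVneq i x.1.
apply: (@mulfI _ ((-1) ^+ x.2)); first by rewrite signr_eq0.
apply/eqP; rewrite eq_le (exit_seq_lt zE (Pe _ yE) zy).
by rewrite (exit_seq_lt yE (Pe _ zE))// => t tx; rewrite zy.
Qed.

(** Terms at points of the ball and of its translate cancel; the others are indexed by the exit
    points in the two opposite directions. *)
Lemma ball_seq_shift n x (g : V -> R) : (forall z, `|g z| <= 1) ->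
  `|\sum_(z <- ball_seq n) g z - \sum_(z <- ball_seq n) g (z + lvec x)| <=
  (size (exit_seq n x) + size (exit_seq n (linv x)))%:R.
Proof.
move=> g1.
rewrite (bigID (fun z => P n (z + lvec (linv x)))) /=.
rewrite [X in _ - X](bigID (fun z => P n (z + lvec x))) /=.
have -> : \sum_(z <- ball_seq n | P n (z + lvec (linv x))) g z =
          \sum_(z <- ball_seq n | P n (z + lvec x)) g (z + lvec x).
  rewrite -big_filter -[RHS]big_filter -(big_map (fun z => z + lvec x) predT g).
  apply: perm_big; apply: uniq_perm.
  - by rewrite filter_uniq// ball_seq_uniq.
  - rewrite map_inj_uniq; last exact: addIr.
    by rewrite filter_uniq// ball_seq_uniq.
  move=> z; rewrite mem_filter mem_ball_seq lvec_linv.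
  apply/andP/mapP => [[Pzv Pz]|[y + ->]].
    by exists (z - lvec x); rewrite ?subrK// mem_filter mem_ball_seq subrK Pz.
  by rewrite mem_filter mem_ball_seq addrK => /andP[].
rewrite [X in X - _]addrC addrKA -big_filter -[X in _ - X]big_filter.
have bound (s : seq V) (h : V -> R) : (forall z, `|h z| <= 1) ->
    `|\sum_(z <- s) h z| <= (size s)%:R.
  move=> h1; rewrite (le_trans (ler_norm_sum _ _ _))//.
  rewrite (le_trans (ler_sum _ (fun z _ => h1 z)))//.
  by rewrite big_const_seq count_predT iter_addr_0.
by rewrite (le_trans (ler_normB _ _))// natrD addrC lerD ?bound.
Qed.

Lemma almost_invariant_ball x :
  almost_invariant (fun n (g : V -> R) => average (ball_seq n) g) (lvec x).
Proof.
(* For each of the two directions, [n] times the number of exit points is at most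
   [(2n+1)^K <= (3n)^K], hence at most [(3K)^K] times the size of the ball. *)
move=> g g1; pose C := (2 * (3 * K) ^ K)%N.
apply/cvgr0Pnorm_le => e e0.
apply: filterS2 (nbhs_infty_gt 0) (near_div_le C%:R e0) => n n0; apply: le_trans.
have s0 : 0 < (size (ball_seq n))%:R :> R by rewrite ltr0n size_ball_seq_gt0.
rewrite /average -mulrBl normrM [X in _ * X]gtr0_norm ?invr_gt0//.
rewrite ler_pdivrMr// (le_trans (ball_seq_shift n x g1))//.
rewrite mulrAC ler_pdivlMr ?ltr0n// -!natrM ler_nat mulnDl /C -mulnA mul2n -addnn.
have bound (x' : letter K) : (size (exit_seq n x') * n <= (3 * K) ^ K * size (ball_seq n))%N.
  rewrite expnMn -mulnA mulnC (@leq_trans (3 ^ K * n ^ K))//; last first.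
    by rewrite leq_mul2l size_ball_seq orbT.
  rewrite -expnMn (@leq_trans (n.*2.+1 ^ K))//; last first.
    by rewrite leq_exp2r//; lia.
  by rewrite (leq_trans _ (size_exit_seq n x'))// leq_mul2r; lia.
exact: leq_add.
Qed.

(** A bad vector of the ball is a multiple of some [d] between [M] and [n]. Such multiples have
    proportion [O(d^-2)], the dimension being at least 2, and these bounds sum to [O(1/M)]. *)
Lemma ball_bad_content (e : R) : 0 < e -> \forall M \near \oo, \forall n \near \oo,
  average (ball_seq n) (@bad_content R k M) <= e.
Proof.
move=> e0; pose C : R := ((3 * K) ^ K)%:R.
have s0 n : 0 < (size (ball_seq n))%:R :> R by rewrite ltr0n size_ball_seq_gt0.
have mult n d : (0 < d <= n)%N ->
    average (ball_seq n) (fun z => (d %| content z)%N%:R) <= C * d%:R ^- 2.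
  move=> /andP[d0 dn]; rewrite /average ler_pdivrMr// -natrX mulrAC.
  rewrite ler_pdivlMr ?ltr0n ?expn_gt0 ?d0//.
  rewrite sum_pred_natr -!natrM ler_nat -size_filter.
  apply: (@leq_trans (size (cube K (n %/ d)) * d ^ 2)).
    rewrite leq_mul2r; apply/orP; right.
    rewrite -[leqRHS](size_map (fun w => d%:Z *: w)); apply: uniq_leq_size => [|z].
      by rewrite filter_uniq// ball_seq_uniq.
    rewrite mem_filter => /andP[dz]; rewrite mem_filter => /andP[_].
    exact: cube_multiples.
  rewrite size_cube; apply: (@leq_trans (((n %/ d).*2.+1 * d) ^ K)).
    by rewrite expnMn leq_mul2l leq_pexp2l ?orbT.
  apply: (@leq_trans ((3 * n) ^ K)).
    rewrite leq_exp2r// mulSn mulnC -mul2n mulnCA.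
    by have := leq_trunc_div n d; lia.
  by rewrite !expnMn -mulnA leq_mul2l size_ball_seq orbT.
have [M0 _ M0P] := near_div_le (C * 2) e0.
exists M0.+1 => // M /= M0M.
have M1 : (0 < M)%N by exact: leq_trans M0M.
exists M => // n /= Mn; apply: le_trans (M0P M (ltnW M0M)).
apply: (@le_trans _ _ (\sum_(M <= d < n.+1) average (ball_seq n)
    (fun z => (d %| content z)%N%:R))); last first.
  rewrite -mulrA; apply: (@le_trans _ _ (\sum_(M <= d < n.+1) C * d%:R ^- 2)).
    rewrite big_nat [leRHS]big_nat; apply: ler_sum => d /andP[Md dn].
    by apply: mult; rewrite (leq_trans M1 Md).
  by rewrite -mulr_sumr ler_wpM2l// sum_inv_sqr_le// M1 leqW.
rewrite -mulr_suml exchange_big; apply: average_le => z.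
rewrite mem_ball_seq => Pz; rewrite /bad_content.
have [//|] := boolP (0 < content z < M)%N; first by rewrite sumr_ge0.
rewrite negb_and -leqNgt leqn0 -leqNgt => bad.
(* The zero vector is charged to [d = M]. *)
pose d := if content z == 0%N then M else content z.
have dz : (d %| content z)%N by rewrite /d; case: eqP => [->|].
have dM : (M <= d < n.+1)%N.
  move: bad; rewrite /d; case: eqVneq => [_ _|c0 /= ->]; first by rewrite leqnn ltnS.
  have [i zi] : exists i, z i ord0 != 0.
    apply/existsP; apply: contraNT c0 => /existsPn z0.
    suff -> : z = 0 by rewrite content0.
    by apply/colP => i; rewrite mxE; apply/eqP; have := z0 i; rewrite negbK.
  by rewrite ltnS (leq_trans (content_le zi))// P_cube.
rewrite (bigD1_seq d) ?mem_index_iota ?iota_uniq//= dz.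
by rewrite lerDl sumr_ge0.
Qed.

End SolidBalls.

(** * Reduced words as mixtures of binomial laws *)

Section BinomialSums.
Variable R : realType.
Implicit Types (n r : nat) (h : nat -> R).

Definition binom_sum n h : R := \sum_(j < n.+1) 'C(n, j)%:R * h j.

Lemma binom_sumS n h : binom_sum n.+1 h = binom_sum n (fun j => h j + h j.+1).
Proof.
rewrite /binom_sum big_ord_recl bin0.
under eq_bigr => j _ do rewrite binS natrD mulrDl.
under [in RHS]eq_bigr => j _ do rewrite mulrDr.
rewrite !big_split /= addrA; congr (_ + _).
by rewrite big_ord_recr /= bin_small// mul0r addr0 [RHS]big_ord_recl bin0.
Qed.

Lemma binom_sum_mulr_index r h :
  binom_sum r (fun j => j%:R * h j) = binom_sum r (fun j => (r - j)%:R * h j.+1).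
Proof.
rewrite /binom_sum big_ord_recl mul0r mulr0 add0r.
rewrite [RHS]big_ord_recr /= subnn mul0r mulr0 addr0.
apply: eq_bigr => j _; rewrite !mulrA -!natrM; congr (_%:R * _).
by rewrite mulnC mul_bin_left mulnC.
Qed.

Lemma binom_sumD n h h' : binom_sum n (fun j => h j + h' j) = binom_sum n h + binom_sum n h'.
Proof. by rewrite -big_split; apply: eq_bigr => j _; rewrite mulrDr. Qed.

Lemma binom_sumZ n c h : binom_sum n (fun j => c * h j) = c * binom_sum n h.
Proof. by rewrite /binom_sum mulr_sumr; apply: eq_bigr => j _; rewrite mulrCA. Qed.

Lemma eq_binom_sum n h h' : (forall j, (j <= n)%N -> h j = h' j) ->
  binom_sum n h = binom_sum n h'.
Proof. by move=> hh; apply: eq_bigr => j _; rewrite hh// -ltnS. Qed.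

(** Coefficientwise this is [(r+1) (C(r,j) - C(r,j-1)) = (r+1-2j) C(r+1,j)]. *)
Lemma binom_sum_diff r h :
  r.+1%:R * (binom_sum r h - binom_sum r (fun j => h j.+1)) =
  binom_sum r.+1 (fun j => (r.+1%:R - 2 * j%:R) * h j).
Proof.
rewrite binom_sumS; have := binom_sum_mulr_index r h.
rewrite (eq_binom_sum (h := fun j => (r.+1%:R - 2 * j%:R) * h j + _)
  (h' := fun j => r.+1%:R * h j + - r.+1%:R * h j.+1 +
    (- 2 * (j%:R * h j) + 2 * ((r - j)%:R * h j.+1)))); last first.
  by move=> j jr; rewrite natrB// -[r.+1%:R]natr1 -[j.+1%:R]natr1; ring.
by rewrite !binom_sumD !binom_sumZ => ->; ring.
Qed.

Lemma binom_sum1 n : binom_sum n (fun=> 1) = 2 ^+ n.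
Proof.
elim: n => [|n IHn]; first by rewrite /binom_sum big_ord1 bin0 mulr1.
by rewrite binom_sumS binom_sumD IHn exprS; ring.
Qed.

(** Up to sign, [n - 2 j] is the position of a simple random walk, whose variance grows by 1 at each
    step. *)
Lemma binom_variance n :
  binom_sum n (fun j => (n%:R - 2 * j%:R) ^+ 2) = n%:R * 2 ^+ n.
Proof.
elim: n => [|n IHn]; first by rewrite /binom_sum big_ord1 mulr0 subr0 expr0n mulr0 mul0r.
rewrite binom_sumS (eq_binom_sum
  (h' := fun j => 2 * (n%:R - 2 * j%:R) ^+ 2 + 2 * 1)); last first.
  by move=> j _; rewrite -[n.+1%:R]natr1 -[j.+1%:R]natr1; ring.
by rewrite binom_sumD !binom_sumZ IHn binom_sum1 -natr1 exprS; ring.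
Qed.

Lemma le_binom_sum n h h' : (forall j, h j <= h' j) -> binom_sum n h <= binom_sum n h'.
Proof. by move=> hh; apply: ler_sum => j _; rewrite ler_wpM2l. Qed.

Lemma binom_absolute_deviation n :
  binom_sum n (fun j => `|n%:R - 2 * j%:R|) <= Num.sqrt n%:R * 2 ^+ n.
Proof.
case: n => [|n].
  by rewrite /binom_sum big_ord1 mulr0 subr0 normr0 mulr0 mulr_ge0 ?sqrtr_ge0 ?exprn_ge0.
set s : R := Num.sqrt _.
have s0 : 0 < s by rewrite sqrtr_gt0.
have s2 : s ^+ 2 = n.+1%:R by rewrite sqr_sqrtr.
(* AM-GM: [|a| <= a^2 / (2 s) + s / 2]. *)
apply: (@le_trans _ _ (binom_sum n.+1
    (fun j => (2 * s)^-1 * (n.+1%:R - 2 * j%:R) ^+ 2 + s / 2 * 1))).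
  apply: le_binom_sum => j; set a : R := _ - _.
  rewrite mulr1 -[a ^+ 2]ger0_norm ?sqr_ge0// normrX.
  have := sqr_ge0 (`|a| - s); move: (`|a|) => b bs.
  have -> : (2 * s)^-1 * b ^+ 2 + s / 2 = (b ^+ 2 + s ^+ 2) / (2 * s).
    by field; rewrite gt_eqF.
  rewrite ler_pdivlMr ?mulr_gt0//.
  by move: bs; rewrite sqrrB; nra.
rewrite binom_sumD !binom_sumZ binom_variance binom_sum1 -s2.
by rewrite le_eqVlt; apply/orP; left; apply/eqP; field; rewrite gt_eqF.
Qed.

End BinomialSums.

Section Halving.
Variables (R : realType) (V : zmodType) (d : V).
Implicit Types (g h : V -> R) (z c : V) (r : nat).

Definition halve g : V -> R := fun z => 2^-1 * (g z + g (z + d)).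

Lemma iter_halve_translate r g c z :
  iter r halve (fun y => g (c + y)) z = iter r halve g (c + z).
Proof. by elim: r z => //= r IHr z; rewrite /halve !IHr addrA. Qed.

Lemma iter_halveE r g z :
  iter r halve g z = 2 ^- r * binom_sum r (fun j => g (z + d *+ j)).
Proof.
elim: r z => [|r IHr] z.
  by rewrite expr0 invr1 mul1r /binom_sum big_ord1 bin0 mul1r addr0.
rewrite /= /halve !IHr binom_sumS binom_sumD exprS invfM -mulrA -mulrDr.
congr (_ * (_ * (_ + _))); apply: eq_bigr => j _.
by rewrite -addrA -mulrS.
Qed.

(* The total variation distance between a binomial law and its translate by one
   is the normalised mean absolute deviation of the next binomial law. *)
Lemma iter_halve_shift r g h z : (forall y, `|g y| <= h y) -> shift d h = h ->
  `|iter r halve g z - iter r halve g (z + d)| <= 2 / Num.sqrt r.+1%:R * h z.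
Proof.
move=> gh hd; have hdn j : h (z + d *+ j) = h z.
  elim: j => [|j IHj]; first by rewrite addr0.
  by rewrite mulrSr addrA -[in RHS]IHj -[in RHS]hd.
have h0 : 0 <= h z by rewrite (le_trans _ (gh z)).
have r0 : 0 < r.+1%:R :> R by rewrite ltr0n.
rewrite !iter_halveE -mulrBr.
have -> : (fun j => g (z + d + d *+ j)) = (fun j => g (z + d *+ j.+1)).
  by apply/funext => j; rewrite -addrA -mulrS.
rewrite -[_ - _](mulKf (lt0r_neq0 r0)) (binom_sum_diff r (fun j => g (z + d *+ j))).
rewrite mulrA normrM [X in X * _]gtr0_norm ?mulr_gt0 ?invr_gt0 ?exprn_gt0//.
apply: (@le_trans _ _ (2 ^- r / r.+1%:R * (h z * (Num.sqrt r.+1%:R * 2 ^+ r.+1)))).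
  rewrite ler_wpM2l ?mulr_ge0 ?invr_ge0 ?exprn_ge0//.
  apply: le_trans (ler_norm_sum _ _ _) _.
  apply: le_trans (ler_wpM2l h0 (binom_absolute_deviation _ r.+1)).
  rewrite -binom_sumZ; apply: ler_sum => j _.
  rewrite normrM ger0_norm// normrM ler_wpM2l// mulrC ler_wpM2r//.
  by rewrite (le_trans (gh _))// hdn.
have s0 : 0 < Num.sqrt r.+1%:R :> R by rewrite sqrtr_gt0.
have s2 : Num.sqrt r.+1%:R ^+ 2 = r.+1%:R :> R by rewrite sqr_sqrtr.
move: s0 s2; set s := Num.sqrt _ => s0 <-; rewrite [2 ^+ r.+1]exprS.
rewrite le_eqVlt; apply/orP; left; apply/eqP; field.
by rewrite gt_eqF// expf_neq0.
Qed.

End Halving.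

Lemma bernoulli_le (R : realFieldType) (x : R) (n : nat) : 0 <= x -> 1 + n%:R * x <= (1 + x) ^+ n.
Proof.
move=> x0; elim: n => [|n IHn]; first by rewrite mul0r addr0 expr0.
have n0 : 0 <= n%:R :> R by [].
rewrite exprS -natr1; apply: le_trans (ler_wpM2l _ IHn); last by rewrite addr_ge0.
by nra.
Qed.

(** * Exchanges of letters in reduced words *)

Section WordSums.
Variables (R : realType) (k : nat).
Local Notation K := k.+2.
Local Notation L := ('I_K * bool)%type.
Local Notation V := 'cV[int]_K.
Implicit Types (l x y : letter K) (w : seq (letter K)) (n : nat).

(** The number [2 K - 1] of letters that may follow a given letter. *)
Local Notation q := (k.*2.+3).

Fixpoint continuations n l : seq (seq (letter K)) :=
  if n is n'.+1 then
    [seq x :: w | x <- [seq x <- enum {: L} | follows l x], w <- continuations n' x]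
  else [:: [::]].

Lemma sum_continuationsS n l (f : seq (letter K) -> R) :
  \sum_(w <- continuations n.+1 l) f w =
  \sum_(x | follows l x) \sum_(w <- continuations n x) f (x :: w).
Proof. by rewrite big_allpairs_dep big_filter big_enum_cond. Qed.

Lemma mem_continuations n l w :
  (w \in continuations n l) = (size w == n) && path (@follows K) l w.
Proof.
elim: n l w => [|n IHn] l w; first by rewrite inE; case: w.
apply/allpairsPdep/andP => [[x [v [+ + ->]]]|].
  rewrite mem_filter IHn mem_enum andbT => lx /andP[/eqP <- xv].
  by rewrite /= eqxx lx.
case: w => [[]//|x w [/= sw /andP[lx xw]]]; exists x, w.
by rewrite mem_filter mem_enum lx IHn xw andbT; split.
Qed.

Lemma sum_follows_const l (c : R) : \sum_(x | follows l x) c = q%:R * c.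
Proof.
rewrite sumr_const (eq_card (B := predC1 (linv l))) => [|x]; last by [].
rewrite cardC1 card_prod card_bool card_ord muln2 /= mulr_natl.
by congr (_ *+ _); rewrite -pred_Sn doubleS.
Qed.

Lemma size_continuations n l : size (continuations n l) = (q ^ n)%N.
Proof.
apply/eqP; rewrite -(eqr_nat R); apply/eqP.
elim: n l => [//|n IHn] l.
rewrite -sum1_size natr_sum sum_continuationsS.
under eq_bigr => x _ do rewrite -natr_sum sum1_size IHn.
by rewrite sum_follows_const expnS natrM.
Qed.

Lemma sum_continuations_const n l (c : R) :
  \sum_(w <- continuations n l) c = (q ^ n)%:R * c.
Proof. by rewrite big_const_seq count_predT iter_addr_0 size_continuations mulr_natl. Qed.

Lemma exists_letter_notin (s : seq (letter K)) : (size s < 4)%N ->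
  exists x, x \notin s.
Proof.
move=> s4; apply/existsP; apply: contraTT s4 => /existsPn sall.
rewrite -leqNgt (@leq_trans #|{: L}|)//.
  by rewrite card_prod card_bool card_ord muln2 !doubleS.
rewrite cardE; apply: uniq_leq_size; first exact: enum_uniq.
by move=> x _; have := sall x; rewrite negbK.
Qed.

Section Flips.
Variables u v : letter K.
Local Notation d := (lvec u - lvec v).

(* In a flippable block [l y x], exchanging [u] and [v] in the middle keeps a
   word reduced. [flips] counts such blocks in the subdivision of a word into
   blocks of three letters, and [flip_base] is the abelianization of the word in
   which all of them have the middle letter [v]. *)
Definition flippable l y x :=
  [&& follows l u, follows l v, (y == u) || (y == v), follows u x & follows v x].

Fixpoint flips w : nat :=
  if w is x :: (y :: (z :: w')) then (flippable x y z + flips w')%N else 0%N.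

Fixpoint flip_base w : V :=
  if w is x :: (y :: (z :: w')) then
    lvec x + lvec (if flippable x y z then v else y) + lvec z + flip_base w'
  else lvec_sum w.

Lemma flips_small w : (size w < 3)%N -> flips w = 0%N /\ flip_base w = lvec_sum w.
Proof. by case: w => [|? [|? [|]]]. Qed.

(** The two vectors differ by one [d] for each flippable block with middle letter [u]. *)
Lemma flip_base_invariant (T : Type) (h : V -> T) w c :
  (forall z, h (z + d) = h z) -> h (c + flip_base w) = h (c + lvec_sum w).
Proof.
move=> hd; have [m] := ubnP (size w).
elim: m w c => // m IHm [|x [|y [|z w]]] c //= sw.
rewrite !addrA IHm; last by lia.
rewrite !lvec_sum_cons !addrA; case: ifP => // /and4P[_ _ /orP[/eqP ->|/eqP ->]//_].
by rewrite -hd; congr h; apply/colP => i; rewrite !mxE; ring.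
Qed.

(** Exchanging [u] and [v] in a flippable block permutes the words, so in the sum over words each
    such block may be replaced by a fair choice between its two forms. The induction removes one
    block of three letters at a time. *)
Lemma flip_sum n l (g : V -> R) :
  \sum_(w <- continuations n l) g (lvec_sum w) =
  \sum_(w <- continuations n l) iter (flips w) (halve d) g (flip_base w).
Proof.
elim/ltn_ind: n l g => n IHn l g.
have [n3|] := ltnP n 3.
  apply: eq_big_seq => w; rewrite mem_continuations => /andP[/eqP sw _].
  by have [|-> ->] := @flips_small w; rewrite ?sw.
case: n IHn => [|[|[|n]]] // IHn _.
rewrite !sum_continuationsS; apply: eq_bigr => x _; rewrite !sum_continuationsS.
under eq_bigr => y _ do rewrite sum_continuationsS.
under [RHS]eq_bigr => y _ do rewrite sum_continuationsS.
(* The sum over the middle letter [y] becomes the inner one, with the outer letters [x] and [z]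
   fixed. *)
rewrite (exchange_big_dep predT) //= [RHS](exchange_big_dep predT) //=.
apply: eq_bigr => z _.
pose A y := \sum_(w <- continuations n z)
  iter (flips w) (halve d) g (lvec x + lvec y + lvec z + flip_base w).
have AE y : \sum_(w <- continuations n z) g (lvec_sum [:: x, y, z & w]) = A y.
  rewrite (eq_bigr (fun w => g (lvec x + lvec y + lvec z + lvec_sum w))); last first.
    by move=> w _; rewrite !lvec_sum_cons !addrA.
  rewrite (IHn n _ z (fun t => g (lvec x + lvec y + lvec z + t)))//.
    by apply: eq_bigr => w _; exact: iter_halve_translate.
  by rewrite ltnS leqW.
under eq_bigr => y _ do rewrite AE.
(* If an outer letter forbids [u] or [v], no middle letter is flippable. Otherwise the transposition
   of [u] and [v] preserves the admissible middle letters, and the sum is averaged with its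
   image. *)
case: (boolP [&& follows x u, follows x v, follows u z & follows v z]) => G; last first.
  apply: eq_bigr => y _; apply: eq_bigr => w _.
  suff -> : flippable x y z = false by [].
  apply: contraNF G => /and5P[-> -> _ -> ->] //.
have [xu xv uz vz] := and4P G.
have GE y : flippable x y z = (y == u) || (y == v).
  by rewrite /flippable xu xv uz vz /= andbT.
pose t := tperm u v.
have tQ y : follows x (t y) && follows (t y) z = follows x y && follows y z.
  by rewrite /t; case: tpermP => [->|->|//]; rewrite xu xv uz vz.
rewrite -[LHS](mulKf (_ : 2 != 0)) ?pnatr_eq0// mulrDl mul1r.
rewrite [in X in _ * (_ + X)](reindex_inj (@perm_inj _ t)) /=.
rewrite (eq_bigl _ _ tQ) -big_split mulr_sumr.
apply: eq_bigr => y _; rewrite GE /A -big_split mulr_sumr; apply: eq_bigr => w _ /=.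
case: (boolP ((y == u) || (y == v))) => [yuv|]; last first.
  rewrite negb_or => /andP[yu yv]; rewrite /t tpermD 1?eq_sym// add0n.
  by field.
rewrite add1n /= /halve.
have -> : lvec x + lvec v + lvec z + flip_base w + (lvec u - lvec v) =
          lvec x + lvec u + lvec z + flip_base w.
  by apply/colP => i; rewrite !mxE; ring.
case/orP: yuv => /eqP ->; rewrite /t ?tpermL ?tpermR// addrC//.
Qed.

Lemma sum_follows_defect l x0 (f : letter K -> R) (b e : R) : follows l x0 ->
  (forall x, f x <= b) -> f x0 <= b - e -> \sum_(x | follows l x) f x <= q%:R * b - e.
Proof.
move=> lx0 fb f0; rewrite -(sum_follows_const l b) (bigD1 x0)//=.
rewrite [X in _ <= X - _](bigD1 x0)//= addrAC.
by apply: lerD => //; apply: ler_sum.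
Qed.

(* After any letter some block is flippable, so that each block of three letters
   contributes a factor at most [1 - 1 / (2 q^3)]. *)
Lemma sum_half_flips n l :
  \sum_(w <- continuations n l) 2 ^- (flips w) <=
  (q ^ n)%:R * (1 - (2 * q ^ 3)%:R^-1) ^+ (n %/ 3) :> R.
Proof.
pose c : R := 1 - (2 * q ^ 3)%:R^-1.
have c0 : 0 <= c.
  rewrite subr_ge0 invf_le1 ?ltr0n ?muln_gt0 ?expn_gt0// ler1n.
  by rewrite muln_gt0 expn_gt0.
have q0 : 0 < q%:R :> R by rewrite ltr0n.
elim/ltn_ind: n l => n IHn l.
have [n3|] := ltnP n 3.
  rewrite divn_small// expr0 mulr1 -[leRHS]mulr1 -(sum_continuations_const n l).
  rewrite big_seq [leRHS]big_seq; apply: ler_sum => w.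
  rewrite mem_continuations => /andP[/eqP sw _].
  by have [|-> _] := @flips_small w; rewrite ?sw// expr0 invr1.
case: n IHn => [|[|[|n]]] // IHn _.
have -> : (n.+3 %/ 3 = (n %/ 3).+1)%N by rewrite -addn3 divnDr// addn1.
pose B : R := (q ^ n)%:R * c ^+ (n %/ 3).
have B0 : 0 <= B by rewrite mulr_ge0// exprn_ge0.
have block x y z : \sum_(w <- continuations n z) 2 ^- flips [:: x, y, z & w] <=
    2 ^- (flippable x y z) * B.
  rewrite /=; under eq_bigr => w _ do rewrite exprD invfM.
  rewrite -mulr_sumr ler_wpM2l ?invr_ge0 ?exprn_ge0//.
  by apply: IHn; rewrite ltnS leqW.
have blockB x y z : \sum_(w <- continuations n z) 2 ^- flips [:: x, y, z & w] <= B.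
  rewrite (le_trans (block x y z))// ler_piMl// invf_le1 ?exprn_gt0//.
  by rewrite exprn_ege1// ler1n.
(* There are at least four letters, which leaves room for outer letters making [x0 u z0] a flippable
   block after [l]. *)
have [x0] := @exists_letter_notin [:: linv l; linv u; linv v] isT.
have [z0] := @exists_letter_notin [:: linv u; linv v] isT.
rewrite !inE !negb_or => /andP[z0u z0v] /and3P[x0l x0u x0v].
have fl : flippable x0 u z0.
  have fx t : x0 != linv t -> follows x0 t by rewrite /follows eq_sym linv_eq.
  by rewrite /flippable !fx// /follows eqxx z0u.
have block0 : \sum_(w <- continuations n z0) 2 ^- flips [:: x0, u, z0 & w] <= B - B / 2.
  rewrite (le_trans (block _ _ _))// fl expr1.
  by rewrite le_eqVlt; apply/orP; left; apply/eqP; field.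
move: (fl) => /and5P[x0fu _ _ uz0 _].
have boundc (f : letter K -> R) m b : (forall x, f x <= b) ->
    \sum_(x | follows m x) f x <= q%:R * b.
  by move=> fb; rewrite -(sum_follows_const m); apply: ler_sum.
rewrite sum_continuationsS.
under eq_bigr => x _ do rewrite sum_continuationsS.
under eq_bigr => x _ do under eq_bigr => y _ do rewrite sum_continuationsS.
(* Each of the [q^3] blocks contributes at most [B], and [x0 u z0] at most [B / 2]. *)
apply: (@le_trans _ _ (q%:R * (q%:R * (q%:R * B)) - B / 2)); last first.
  have -> : (q ^ n.+3)%:R * c ^+ (n %/ 3).+1 = q%:R ^+ 3 * c * B.
    by rewrite /B !natrX [c ^+ _.+1]exprS -[n.+3]addn3 exprD; ring.
  have -> : q%:R ^+ 3 * c = q%:R ^+ 3 - 2^-1.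
    by rewrite /c natrM natrX; field; rewrite gt_eqF.
  by rewrite le_eqVlt; apply/orP; left; apply/eqP; ring.
apply: (sum_follows_defect (x0 := x0)) => //.
- move=> x; apply: (boundc _ _ _) => y; apply: (boundc _ _ _) => z.
  exact: blockB.
apply: (sum_follows_defect (x0 := u)) => //.
- by move=> y; apply: (boundc _ _ _) => z; exact: blockB.
by apply: (sum_follows_defect (x0 := z0)).
Qed.

Local Notation blocks := ((2 * q ^ 3)%N).

(** Markov's inequality for [2 ^- flips w]. With [a = 1 / blocks], Bernoulli gives
    [2^m <= (1 + a)^t], so the proportion is at most [(1 - a^2)^t <= 1 / (1 + t a^2)], of order
    [1 / n]. *)
Lemma rare_flips n l : (0 < n)%N ->
  \sum_(w <- continuations n l) (flips w < n %/ 3 %/ blocks)%N%:R <=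
  (3 * blocks ^ 2)%:R / n%:R * (q ^ n)%:R :> R.
Proof.
move=> n0; set m := (_ %/ _)%N; set t := (n %/ 3)%N in m *.
have L0 : 0 < blocks%:R :> R by rewrite ltr0n muln_gt0 expn_gt0.
pose a : R := blocks%:R^-1.
have a0 : 0 < a by rewrite invr_gt0.
have a1 : a <= 1 by rewrite invf_le1// ler1n -(ltr0n R).
have two_le : 2 ^+ m <= (1 + a) ^+ t.
  apply: (@le_trans _ _ ((1 + a) ^+ (blocks * m))); last first.
    by rewrite ler_weXn2l ?lerDl ?(ltW a0)// mulnC leq_trunc_div.
  rewrite exprM lerXn2r ?nnegrE ?exprn_ge0 ?addr_ge0 ?(ltW a0)//.
  apply: le_trans (bernoulli_le _ (ltW a0)).
  by rewrite /a divff ?gt_eqF.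
have half w : (flips w < m)%N%:R <= 2 ^+ m * 2 ^- flips w :> R.
  case: ltnP => [fm|_]; last by rewrite mulr_ge0 ?invr_ge0 ?exprn_ge0.
  by rewrite ler_pdivlMr ?exprn_gt0// mul1r ler_weXn2l ?ler1n// ltnW.
rewrite (le_trans (ler_sum _ (fun w _ => half w)))// -mulr_sumr.
rewrite (le_trans (ler_wpM2l _ (sum_half_flips n l))) ?exprn_ge0// mulrCA mulrC.
rewrite ler_wpM2r// -/a -/t.
rewrite (le_trans (ler_wpM2r _ two_le)) ?exprn_ge0 ?subr_ge0//.
rewrite -exprMn -[leLHS]mul1r.
have b0 : 0 < (1 + a ^+ 2) ^+ t by rewrite exprn_gt0// addr_gt0// exprn_gt0.
apply: (@le_trans _ _ ((1 + a ^+ 2) ^- t)).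
  rewrite mul1r -[leRHS]mul1r ler_pdivlMr// -exprMn.
  have -> : (1 + a) * (1 - a) * (1 + a ^+ 2) = 1 - a ^+ 4 by ring.
  by rewrite exprn_ile1// ?gerBl ?subr_ge0 ?exprn_ile1 ?exprn_ge0// ltW.
apply: (@le_trans _ _ (1 + t%:R * a ^+ 2)^-1).
  rewrite lef_pV2 ?posrE//; last by rewrite ltr_wpDr// mulr_ge0// sqr_ge0.
  by rewrite bernoulli_le// sqr_ge0.
rewrite -[leRHS]invrK lef_pV2 ?posrE; last 2 first.
- by rewrite ltr_wpDr// mulr_ge0// sqr_ge0.
- by rewrite invr_gt0 divr_gt0 ?ltr0n// !muln_gt0 !expn_gt0.
rewrite invf_div ler_pdivrMr ?ltr0n ?muln_gt0 ?expn_gt0//.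
have -> : a ^+ 2 = (blocks ^ 2)%:R^-1 by rewrite natrX -exprVn.
have B1 : 1 <= (blocks ^ 2)%:R :> R by rewrite ler1n expn_gt0 muln_gt0 expn_gt0.
rewrite natrM; move: B1; set b := (blocks ^ 2)%:R => B1.
have -> : (1 + t%:R * b^-1) * (3 * b) = 3 * b + 3 * t%:R.
  by field; rewrite gt_eqF// (lt_le_trans _ B1).
have : n%:R <= 3 * t%:R + 3 :> R.
  rewrite -natrM -natrD ler_nat /t {1}(divn_eq n 3) mulnC leq_add2l.
  by rewrite ltnW// ltn_pmod.
by lra.
Qed.

(** Covers both errors in [flip_shift]: [6 * blocks] from the binomial estimate and twice
    [3 * blocks ^ 2] from the rare words. *)
Definition mixing_const : nat := 6 * blocks ^ 2.

(** Words with at least [m] flippable blocks obey the binomial estimate; the others are rare and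
    cost at most [2 * B] more each. The [d]-invariant majorant [H] keeps the main error proportional
    to the mass of [H], which allows conditioning on another coordinate. *)
Lemma flip_shift n l (G H : V -> R) (B : R) : (0 < n)%N ->
  (forall z, `|G z| <= H z) -> shift d H = H -> (forall z, H z <= B) ->
  `|\sum_(w <- continuations n l) G (lvec_sum w)
    - \sum_(w <- continuations n l) G (lvec_sum w + d)| <=
  mixing_const%:R / Num.sqrt n%:R * \sum_(w <- continuations n l) H (lvec_sum w)
  + mixing_const%:R / n%:R * B * (q ^ n)%:R.
Proof.
move=> n0 GH Hd HB; pose m := (n %/ 3 %/ blocks)%N.
have H0 z : 0 <= H z by rewrite (le_trans _ (GH z)).
have n0R : 0 < n%:R :> R by rewrite ltr0n.
have -> : \sum_(w <- continuations n l) G (lvec_sum w + d) =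
    \sum_(w <- continuations n l) iter (flips w) (halve d) G (flip_base w + d).
  rewrite (flip_sum n l (fun z => G (z + d))); apply: eq_bigr => w _.
  rewrite [flip_base w + d]addrC -iter_halve_translate.
  by congr (iter _ _ _ _); apply/funext => z; rewrite addrC.
rewrite flip_sum -sumrB.
pose bnd w := mixing_const%:R / Num.sqrt n%:R * H (lvec_sum w) + (flips w < m)%N%:R * (2 * B).
have step w : `|iter (flips w) (halve d) G (flip_base w) -
    iter (flips w) (halve d) G (flip_base w + d)| <= bnd w.
  rewrite (le_trans (iter_halve_shift _ _ GH Hd))//.
  have -> : H (flip_base w) = H (lvec_sum w).
    rewrite -[flip_base w]add0r -[lvec_sum w]add0r flip_base_invariant// => z.
    by rewrite -[in RHS]Hd.
  rewrite /bnd; have [fm|fm] := ltnP (flips w) m; last first.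
    rewrite mul0r addr0 ler_wpM2r// ler_pdivrMr ?sqrtr_gt0// mulrAC.
    rewrite ler_pdivlMr ?sqrtr_gt0//.
    (* This comes from [n <= 3 * blocks * (m + 1)] and [m <= flips w]. *)
    have : Num.sqrt n%:R <= (3 * blocks)%:R * Num.sqrt (flips w).+1%:R :> R.
      have -> : (3 * blocks)%:R = Num.sqrt ((3 * blocks)%:R ^+ 2) :> R.
        by rewrite sqrtr_sqr ger0_norm.
      rewrite -sqrtrM ?sqr_ge0// ler_sqrt; last by rewrite mulr_ge0// sqr_ge0.
      rewrite -natrX -natrM ler_nat.
      have b0 : (0 < 3 * blocks)%N by rewrite 2!muln_gt0 expn_gt0.
      apply: (@leq_trans (m.+1 * (3 * blocks))).
        by rewrite /m -divnMA ltnW// ltn_ceil.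
      move: b0; set X := (3 * blocks)%N => b0.
      rewrite -mulnn mulnC -mulnA leq_mul2l; apply/orP; right.
      by rewrite (@leq_trans (flips w).+1)// leq_pmull.
    move/(ler_wpM2l (ler0n R 2))/le_trans; apply.
    rewrite mulrA -natrM ler_wpM2r ?sqrtr_ge0// ler_nat mulnA leq_mul2l/=.
    by rewrite leq_pmulr// muln_gt0 expn_gt0.
  rewrite mul1r ler_wpDl//; first by rewrite mulr_ge0// divr_ge0// sqrtr_ge0.
  rewrite ler_pM ?divr_ge0 ?sqrtr_ge0//.
  rewrite ler_pdivrMr ?sqrtr_gt0// ler_peMr//.
  by rewrite -[X in X <= _]sqrtr1 ler_sqrt// ler1n.
rewrite (le_trans (ler_norm_sum _ _ _))// (le_trans (ler_sum _ (fun w _ => step w)))//.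
rewrite big_split /= -mulr_sumr lerD2l -mulr_suml.
have B0 : 0 <= B by rewrite (le_trans (H0 0)).
rewrite (le_trans (ler_wpM2r _ (rare_flips l n0))) ?mulr_ge0//.
rewrite le_eqVlt; apply/orP; left; apply/eqP.
by rewrite /mixing_const !natrM; ring.
Qed.

End Flips.

Definition reduced_words n : seq (seq (letter K)) :=
  if n is n'.+1 then [seq x :: w | x <- enum {: L}, w <- continuations n' x]
  else [:: [::]].

Lemma mem_reduced_words n w :
  (w \in reduced_words n) = freely_reduced w && (size w == n).
Proof.
rewrite freely_reducedE; case: n => [|n]; first by rewrite inE; case: w => //= x w; rewrite andbF.
apply/allpairsPdep/andP => [[x [v [_ + ->]]]|].
  by rewrite mem_continuations => /andP[/eqP <- xv] /=.
case: w => [[]//|x w [/= xw sw]]; exists x, w.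
by rewrite mem_enum mem_continuations xw andbT; split.
Qed.

Lemma continuations_uniq n l : uniq (continuations n l).
Proof.
elim: n l => //= n IHn l; apply: allpairs_uniq_dep.
- by rewrite filter_uniq// enum_uniq.
- by move=> x _; exact: IHn.
- by move=> [x v] [y w] _ _ /= [-> ->].
Qed.

Lemma reduced_words_uniq n : uniq (reduced_words n).
Proof.
case: n => //= n; apply: allpairs_uniq_dep; first exact: enum_uniq.
- by move=> x _; exact: continuations_uniq.
- by move=> [x v] [y w] _ _ /= [-> ->].
Qed.

Lemma sum_reduced_wordsS n (f : seq (letter K) -> R) :
  \sum_(w <- reduced_words n.+1) f w =
  \sum_(x : letter K) \sum_(w <- continuations n x) f (x :: w).
Proof. by rewrite big_allpairs_dep big_enum. Qed.

Definition sphere_mean n (g : V -> R) : R :=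
  average [seq lvec_sum w | w <- reduced_words n] g.

Definition word_mean n l (g : V -> R) : R :=
  average [seq lvec_sum w | w <- continuations n l] g.

Lemma word_meanE n l g : word_mean n l g =
  (\sum_(w <- continuations n l) g (lvec_sum w)) / (q ^ n)%:R.
Proof. by rewrite /word_mean /average size_map size_continuations big_map. Qed.

Lemma size_reduced_words_gt0 n : (0 < size (reduced_words n))%N.
Proof.
case: n => //= n; have [x _] := @exists_letter_notin [::] isT.
have : (0 < size (continuations n x))%N by rewrite size_continuations expn_gt0.
case E : (continuations n x) => [//|w s] _.
rewrite lt0n size_eq0; apply/eqP => e; suff : x :: w \in [::] by [].
rewrite -e; apply/allpairsPdep; exists x, w; split=> //; first exact: mem_enum.
by rewrite E mem_head.
Qed.

Lemma mean_sphere n : mean (sphere_mean n).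
Proof. by apply: mean_average; rewrite size_map size_reduced_words_gt0. Qed.

Lemma card_letters : #|{: L}| = (2 * K)%N.
Proof. by rewrite card_prod card_bool card_ord mulnC. Qed.

(** A nonempty reduced word may follow exactly [q] letters, so summing over the preceding letter
    counts each word equally often. *)
Lemma sphere_meanE n g : sphere_mean n g = (2 * K)%:R^-1 * \sum_l word_mean n l g.
Proof.
have q0 : q%:R != 0 :> R by rewrite pnatr_eq0.
have K0 : (2 * K)%:R != 0 :> R by rewrite pnatr_eq0 muln_eq0.
case: n => [|n].
  rewrite (eq_bigr (fun=> g 0)) => [|l _]; last first.
    by rewrite word_meanE /= big_seq1 /lvec_sum big_nil divr1.
  rewrite sumr_const card_letters -[g 0 *+ _]mulr_natl mulKf//.
  by rewrite /sphere_mean /average /= big_seq1 /lvec_sum big_nil divr1.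
pose A x := \sum_(w <- continuations n x) g (lvec_sum (x :: w)).
have sizeE : (size (reduced_words n.+1))%:R = (2 * K)%:R * (q ^ n)%:R :> R.
  rewrite -sum1_size natr_sum sum_reduced_wordsS.
  under eq_bigr => x _ do rewrite sum_continuations_const mulr1.
  by rewrite sumr_const card_letters mulr_natl.
rewrite /sphere_mean /average size_map sizeE big_map sum_reduced_wordsS -/(A _).
under [in RHS]eq_bigr => l _ do rewrite word_meanE sum_continuationsS.
rewrite -mulr_suml (exchange_big_dep predT)//=.
have -> : \sum_(x : letter K) \sum_(l | follows l x) A x = q%:R * \sum_(x : letter K) A x.
  rewrite mulr_sumr; apply: eq_bigr => x _; rewrite -(sum_follows_const x).
  by apply: eq_bigl => l; rewrite /follows eq_sym linv_eq.
rewrite expnS natrM; field.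
by rewrite -!natrD !pnatr_eq0 expn_eq0.
Qed.

Lemma sphere_mean_shift n x y (G H : V -> R) (B : R) : (0 < n)%N ->
  (forall z, `|G z| <= H z) -> shift (lvec x - lvec y) H = H -> (forall z, H z <= B) ->
  `|sphere_mean n G - sphere_mean n (shift (lvec x - lvec y) G)| <=
  mixing_const%:R / Num.sqrt n%:R * sphere_mean n H + mixing_const%:R / n%:R * B.
Proof.
move=> n0 GH Hd HB; rewrite !sphere_meanE -mulrBr -sumrB normrM ger0_norm ?invr_ge0//.
have K0 : 0 < (2 * K)%:R :> R by rewrite ltr0n.
rewrite ler_pdivrMl// mulrDr mulrCA mulVKf ?gt_eqF//.
have -> : (2 * K)%:R * (mixing_const%:R / n%:R * B) =
    \sum_(l : letter K) mixing_const%:R / n%:R * B.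
  by rewrite sumr_const card_letters mulr_natl.
rewrite mulr_sumr -big_split (le_trans (ler_norm_sum _ _ _))//.
apply: ler_sum => l _; rewrite !word_meanE /=.
have qn0 : 0 < (q ^ n)%:R :> R by rewrite ltr0n expn_gt0.
rewrite -mulrBl normrM [X in _ * X]gtr0_norm ?invr_gt0// ler_pdivrMr//.
rewrite mulrDl -[_ * _ * (q ^ n)%:R]mulrA divfK ?gt_eqF//.
exact: flip_shift.
Qed.

End WordSums.

(** * Content on the spheres of the free group *)

(** Two solutions differ by at least [d / 2], so three would not fit below [i]. The step 2 is the
    effect of exchanging a generator with its inverse. *)
Lemma sum_dvdz_progression (R : realType) (c : int) (d i : nat) : (0 < d)%N -> (i <= d)%N ->
  \sum_(s < i) (d%:Z %| c + (2 * s)%:Z)%Z%:R <= 2 :> R.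
Proof.
move=> d0 id.
pose p : pred nat := fun s => (d%:Z %| c + (2 * s)%N%:Z)%Z.
rewrite -(big_mkord predT (fun s => (p s)%:R)).
rewrite sum_pred_natr (ler_nat R _ 2) -size_filter.
case E : (seq.filter p _) => [|s0 [|s1 [|s2 t]]] //.
have : sorted ltn [seq s <- index_iota 0 i | p s].
  by apply: sorted_filter; [exact: ltn_trans|exact: iota_ltn_sorted].
rewrite E /= => /and3P[s01 s12 _].
have mem s : s \in [:: s0, s1, s2 & t] -> p s /\ (s < i)%N.
  by rewrite -E mem_filter mem_index_iota => /andP[].
have [p0 _] : p s0 /\ (s0 < i)%N by apply: mem; rewrite !inE eqxx.
have [p1 _] : p s1 /\ (s1 < i)%N by apply: mem; rewrite !inE eqxx orbT.
have [p2 s2i] : p s2 /\ (s2 < i)%N by apply: mem; rewrite !inE eqxx !orbT.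
have gap a b : p a -> p b -> (a < b)%N -> (d <= 2 * (b - a))%N.
  move=> pa pb ab; apply: dvdn_leq; first by rewrite muln_gt0 subn_gt0.
  have := rpredB pb pa.
  have -> : c + (2 * b)%N%:Z - (c + (2 * a)%N%:Z) = (2 * (b - a))%N%:Z by lia.
  by rewrite dvdzE.
have := gap _ _ p0 p1 s01; have := gap _ _ p1 p2 s12; lia.
Qed.

Section SphereContent.
Variables (R : realType) (k : nat).
Local Notation K := k.+2.
Local Notation V := 'cV[int]_K.
Local Notation q := (k.*2.+3).
Local Notation sphere_mean := (@sphere_mean R k).
Local Notation C := ((mixing_const k)%:R : R).

Definition divides_coord (c : 'I_K) d : V -> R := fun z => (d%:Z %| z c ord0)%Z%:R.

(** Among [d] successive translates along [e] at most two satisfy the divisibility, and all have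
    nearly the same mean, with an error uniform in the translate. *)
Lemma sphere_divides n c d (H : V -> R) : (0 < n)%N -> (0 < d)%N ->
  (forall z, 0 <= H z <= 1) -> shift (lvec (c, false) - lvec (c, true)) H = H ->
  sphere_mean n (fun z => divides_coord c d z * H z) <=
  (2 / d%:R + 2 * C / Num.sqrt n%:R) * sphere_mean n H + 2 * C / n%:R.
Proof.
set e := lvec _ - _ => n0 d0 H01 He.
have H0 z : 0 <= H z by case/andP: (H01 z).
have H1 z : H z <= 1 by case/andP: (H01 z).
have d0R : 0 < d%:R :> R by rewrite ltr0n.
pose g z := divides_coord c d z * H z.
pose G i z := \sum_(s < i) g (z + e *+ s).
have Hs z s : H (z + e *+ s) = H z.
  by elim: s => [|s IHs]; rewrite ?addr0// mulrSr addrA -[in RHS]IHs -[in RHS]He.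
have ec z s : (z + e *+ s) c ord0 = z c ord0 + (2 * s)%N%:Z.
  rewrite mxE mulmxnE /e /lvec /= !mxE !eqxx /= opprK; lia.
have G0 i z : 0 <= G i z by apply: sumr_ge0 => s _; rewrite mulr_ge0.
have G2 i z : (i <= d)%N -> G i z <= 2 * H z.
  move=> id; rewrite /G /g.
  under eq_bigr => s _ do rewrite Hs.
  rewrite -mulr_suml ler_wpM2r//.
  apply: le_trans (sum_dvdz_progression R (z c ord0) d0 id).
  by apply: ler_sum => s _; rewrite /divides_coord ec.
pose mm := mean_sphere R k n.
(* Differences of [g] along multiples of [e] are differences along [e] itself of
   the sums [G i], which stay bounded by [2 * H]. *)
have telescope i z : g z - g (z + e *+ i) = G i z - G i (z + e).
  rewrite /G; elim: i => [|i IHi]; first by rewrite !big_ord0 addr0 !subrr.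
  rewrite !big_ord_recr /= -[z + e + e *+ i]addrA -mulrS.
  have -> : g z - g (z + e *+ i.+1) =
      (g z - g (z + e *+ i)) + (g (z + e *+ i) - g (z + e *+ i.+1)) by ring.
  by rewrite IHi; ring.
pose r : R := C / Num.sqrt n%:R * (2 * sphere_mean n H) + C / n%:R * 2.
have diff i : (i <= d)%N -> sphere_mean n g <= sphere_mean n (fun z => g (z + e *+ i)) + r.
  move=> id; rewrite -lerBlDl -meanB//.
  have -> : (fun z => g z - g (z + e *+ i)) = (fun z => G i z - shift e (G i) z).
    by apply/funext => z; exact: telescope.
  rewrite meanB// (le_trans (ler_norm _))// /r -meanZ//.
  apply: sphere_mean_shift => //.
  - by move=> z; rewrite ger0_norm// G2.
  - by apply/funext => z; rewrite /shift -[in RHS]He.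
  - by move=> z; rewrite ler_piMr.
have : d%:R * sphere_mean n g <= 2 * sphere_mean n H + d%:R * r.
  have -> : d%:R * sphere_mean n g = \sum_(i < d) sphere_mean n g.
    by rewrite sumr_const card_ord mulr_natl.
  have -> : d%:R * r = \sum_(i < d) r by rewrite sumr_const card_ord mulr_natl.
  apply: (@le_trans _ _ (\sum_(i < d) (sphere_mean n (fun z => g (z + e *+ i)) + r))).
    by apply: ler_sum => i _; apply: diff; exact: ltnW.
  rewrite big_split lerD2r -mean_sum// -meanZ//; apply: mean_le => // z.
  exact: G2.
rewrite -ler_pdivlMl// => /le_trans; apply; rewrite /r.
by rewrite le_eqVlt; apply/orP; left; apply/eqP; field;
   rewrite ?gt_eqF ?sqrtr_gt0 ?ltr0n.
Qed.

End SphereContent.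

(** * Second moment of a coordinate on spheres *)

Section SphereSecondMoment.
Variables (R : realType) (k : nat) (c : 'I_k.+2).
Local Notation K := k.+2.
Local Notation V := 'cV[int]_K.
Local Notation q := (k.*2.+3).

Definition coord (z : V) : R := (z c ord0)%:~R.

Lemma coordD z z' : coord (z + z') = coord z + coord z'.
Proof. by rewrite /coord mxE intrD. Qed.

Lemma coordN z : coord (- z) = - coord z.
Proof. by rewrite /coord mxE intrN. Qed.

Lemma coord_lvec_sqr (x : letter K) : coord (lvec x) ^+ 2 <= 1.
Proof.
rewrite /coord lvecE; case: eqP => _; last by rewrite expr0n.
by case: (x.2); rewrite /= ?rmorphN ?sqrrN expr1n.
Qed.

(** All letters together sum to zero, so omitting [linv l] leaves [lvec l]. *)
Lemma sum_follows_coord (l : letter K) :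
  \sum_(x | follows l x) coord (lvec x) = coord (lvec l).
Proof.
have tot : \sum_(x : letter K) coord (lvec x) = 0.
  have : \sum_(x : letter K) coord (lvec x) = - \sum_(x : letter K) coord (lvec x).
    rewrite {1}(reindex_inj (inv_inj (@linvK K))) -sumrN.
    by apply: eq_bigr => x _; rewrite lvec_linv coordN.
  by lra.
move: tot; rewrite (bigD1 (linv l))//= lvec_linv coordN => /eqP.
by rewrite addrC subr_eq0 => /eqP.
Qed.

Lemma continuations_first_moment n (l : letter K) :
  \sum_(w <- continuations n l) coord (lvec_sum w) =
  (\sum_(i < n) q ^ i)%N%:R * coord (lvec l).
Proof.
elim: n l => [|n IHn] l.
  by rewrite big_seq1 /lvec_sum big_nil big_ord0 mul0r /coord mxE.
rewrite sum_continuationsS.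
under eq_bigr => x _.
  under eq_bigr => w _ do rewrite lvec_sum_cons coordD.
  rewrite big_split /= sum_continuations_const IHn -mulrDl -natrD addnC.
  over.
by rewrite -mulr_sumr sum_follows_coord big_ord_recr.
Qed.

Lemma geometric_sum_le n : (\sum_(i < n) q ^ i <= q ^ n)%N.
Proof.
elim: n => [|n IHn]; first by rewrite big_ord0.
rewrite big_ord_recr /= expnS (leq_trans (leq_add IHn (leqnn _)))//.
by rewrite addnn -mul2n leq_mul2r orbT.
Qed.

(** Expanding the square at the first letter, the square of its coordinate adds at most [q^n] and
    the cross term, through a geometric sum, at most [2 q^n]: hence the factor 3. *)
Lemma continuations_second_moment n (l : letter K) :
  \sum_(w <- continuations n l) coord (lvec_sum w) ^+ 2 <= (3 * n * q ^ n)%:R.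
Proof.
elim: n l => [|n IHn] l.
  by rewrite big_seq1 /lvec_sum big_nil /coord mxE expr0n.
rewrite sum_continuationsS.
apply: (@le_trans _ _ (\sum_(x | follows l x) (3 * n.+1 * q ^ n)%:R)); last first.
  by rewrite (sum_follows_const l) -natrM ler_nat mulnCA expnS.
apply: ler_sum => x _.
under eq_bigr => w _ do rewrite lvec_sum_cons coordD sqrrD -addrA.
rewrite big_split sum_continuations_const big_split /=.
under [X in _ + (X + _)]eq_bigr => w _ do rewrite -mulr_natl mulrA.
rewrite -mulr_sumr continuations_first_moment.
have := IHn x; have x1 := coord_lvec_sqr x.
have : (\sum_(i < n) q ^ i)%N%:R <= (q ^ n)%:R :> R by rewrite ler_nat geometric_sum_le.
have : 0 <= (\sum_(i < n) q ^ i)%N%:R :> R by [].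
move: (\sum_(i < n) _)%N%:R => a a0; rewrite !natrM -natr1.
move: (coord (lvec x)) x1 => y y1; move: (q ^ n)%:R => Q aQ.
move: (\sum_(w <- _) _) => S SQ.
have Q0 : 0 <= Q by exact: le_trans aQ.
have y0 : 0 <= y ^+ 2 by exact: sqr_ge0.
have := ler_pM a0 y0 aQ y1; nra.
Qed.

Lemma sphere_second_moment n : sphere_mean n (fun z => coord z ^+ 2) <= 3 * n%:R.
Proof.
rewrite sphere_meanE ler_pdivrMl ?ltr0n//.
apply: (@le_trans _ _ (\sum_(l : letter K) 3 * n%:R)); last first.
  by rewrite sumr_const card_letters [leRHS]mulr_natl.
apply: ler_sum => l _; rewrite word_meanE ler_pdivrMr ?ltr0n ?expn_gt0//.
by rewrite -!natrM continuations_second_moment.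
Qed.

End SphereSecondMoment.

Lemma near_div_sqrt_le (R : realType) (C e : R) : 0 <= C -> 0 < e ->
  \forall n \near \oo, C / Num.sqrt n%:R <= e.
Proof.
move=> C0 e0; apply: filterS2 (nbhs_infty_gt 0) (nbhs_infty_ger ((C / e) ^+ 2)) => n n0.
rewrite -ler_sqrt// sqrtr_sqr ger0_norm; last by rewrite divr_ge0// ltW.
by rewrite !ler_pdivrMr ?sqrtr_gt0 ?ltr0n// mulrC.
Qed.

(** * Large contents on spheres *)

Section SphereTail.
Variables (R : realType) (k : nat).
Local Notation K := k.+2.
Local Notation V := 'cV[int]_K.
Local Notation C := ((mixing_const k)%:R : R).
Implicit Types (n d M J : nat).

Local Notation P := (@divides_coord R k ord0).
Local Notation Q := (@divides_coord R k ord_max).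

Lemma divides_coord01 c d (z : V) : 0 <= divides_coord R c d z <= 1.
Proof. by rewrite /divides_coord ler0n lern1; case: (_ %| _)%Z. Qed.

Lemma sphere_divides1 n d : (0 < n)%N -> (0 < d)%N ->
  sphere_mean n (P d) <= 2 / d%:R + 4 * C / Num.sqrt n%:R.
Proof.
move=> n0 d0.
have one01 (z : V) : 0 <= (1 : R) <= 1 by rewrite ler01 lexx.
have := @sphere_divides R k n ord0 d (fun=> 1) n0 d0 one01 erefl.
rewrite (mean_cst (mean_sphere _ _ _)) mulr1.
have -> : (fun z => P d z * 1) = P d by apply/funext => z; rewrite mulr1.
have n0R : 1 <= n%:R :> R by rewrite ler1n.
have s0 : 0 < Num.sqrt n%:R :> R by rewrite sqrtr_gt0 ltr0n.
have : 2 * C / n%:R <= 2 * C / Num.sqrt n%:R.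
  rewrite ler_wpM2l// lef_pV2 ?posrE ?ltr0n//.
  rewrite -[leRHS]sqr_sqrtr// expr2 ler_peMr ?sqrtr_ge0//.
  by rewrite -[leLHS]sqrtr1 ler_sqrt.
move: s0; set s := Num.sqrt _ => s0 le1 le2.
rewrite (le_trans le2)// -addrA lerD2l (le_trans (lerD (lexx _) le1))//.
by rewrite le_eqVlt; apply/orP; left; apply/eqP; field; rewrite gt_eqF.
Qed.

(** Divisibility of the first coordinate is a weight invariant along the last one, so
    [sphere_divides] applies twice. In this range of [d] the errors [n^(-1/2)] and [1/n] are at most
    [J / d] and [J^2 / d^2]. *)
Lemma sphere_divides2 n d J : (0 < n)%N -> (0 < d)%N -> (d ^ 2 <= J ^ 2 * n)%N ->
  sphere_mean n (fun z => Q d z * P d z) <=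
  ((2 + 4 * C * J%:R) ^+ 2 + 2 * C * J%:R ^+ 2) * d%:R ^- 2.
Proof.
move=> n0 d0 dJ.
have n0R : 0 < n%:R :> R by rewrite ltr0n.
have d0R : 0 < d%:R :> R by rewrite ltr0n.
have s0 : 0 < Num.sqrt n%:R :> R by rewrite sqrtr_gt0.
have s2 : Num.sqrt n%:R ^+ 2 = n%:R :> R by rewrite sqr_sqrtr// ltW.
have dJR : d%:R ^+ 2 <= J%:R ^+ 2 * n%:R :> R by rewrite -!natrX -natrM ler_nat.
have dJs : (Num.sqrt n%:R)^-1 <= J%:R / d%:R :> R.
  rewrite ler_pdivlMr// mulrC ler_pdivrMr//.
  rewrite -[leRHS]ger0_norm ?mulr_ge0 ?sqrtr_ge0// -sqrtr_sqr exprMn s2.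
  by rewrite -[leLHS]ger0_norm// -sqrtr_sqr ler_sqrt// mulr_ge0// sqr_ge0.
apply: le_trans (@sphere_divides R k n ord_max d (P d) n0 d0 _ _) _.
- by move=> z; exact: divides_coord01.
- apply/funext => z; rewrite /shift /divides_coord /lvec /= !mxE /=.
  by rewrite !oppr0 !addr0.
have le1 := sphere_divides1 n0 d0.
set s := (Num.sqrt n%:R) in s0 s2 dJs le1 *.
have C0 : 0 <= C by [].
have D : 2 / d%:R + 4 * C / s <= (2 + 4 * C * J%:R) / d%:R.
  by rewrite [leRHS]mulrDl lerD2l -!mulrA !ler_wpM2l.
have D0 : 0 <= 2 / d%:R + 4 * C / s by rewrite addr_ge0 ?divr_ge0 ?mulr_ge0// ltW.
have D1 : 2 / d%:R + 2 * C / s <= 2 / d%:R + 4 * C / s.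
  by rewrite lerD2l ler_wpM2r ?invr_ge0 ?(ltW s0)// ler_wpM2r// ler_nat.
rewrite [leRHS]mulrDl -!exprVn lerD//.
  rewrite -exprMn expr2; apply: ler_pM; rewrite ?(le_trans D1)//.
  - by rewrite addr_ge0 ?divr_ge0 ?mulr_ge0// ltW.
  - have [_ ge0 _] := mean_sphere R k n; apply: ge0 => z.
    by have /andP[] := divides_coord01 ord0 d z.
  - exact: le_trans le1 D.
rewrite -!mulrA !ler_wpM2l// mulrA -expr2 -s2 -exprVn -exprMn.
by rewrite ler_sqr ?nnegrE ?divr_ge0 ?invr_ge0 ?(ltW s0).
Qed.

(** The three terms handle a zero first coordinate, a first coordinate beyond [J n^(1/2)], and
    otherwise the value [d = content z], which divides both the first and the last coordinate. *)
Lemma bad_content_le M J n (z : V) : (0 < M)%N -> (0 < J)%N -> (0 < n)%N ->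
  bad_content R M z <= P M z + (J ^ 2 * n)%:R^-1 * coord R ord0 z ^+ 2
    + \sum_(M <= d < (J ^ 2 * n).+1 | (d ^ 2 <= J ^ 2 * n)%N) Q d z * P d z.
Proof.
move=> M0 J0 n0; set X := (J ^ 2 * n)%N.
have X0 : (0 < X)%N by rewrite muln_gt0 expn_gt0 J0.
have ge1 : 0 <= P M z by have /andP[] := divides_coord01 ord0 M z.
have ge2 : 0 <= X%:R^-1 * coord R ord0 z ^+ 2 by rewrite mulr_ge0 ?sqr_ge0.
have ge3 : 0 <= \sum_(M <= d < X.+1 | (d ^ 2 <= X)%N) Q d z * P d z.
  apply: sumr_ge0 => d _; apply: mulr_ge0.
    by have /andP[] := divides_coord01 ord_max d z.
  by have /andP[] := divides_coord01 ord0 d z.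
rewrite /bad_content; have [_|] := boolP (0 < content z < M)%N; first by rewrite !addr_ge0.
rewrite negb_and -eqn0Ngt -leqNgt => bad; rewrite /=.
have [z0|z0] := eqVneq (z ord0 ord0) 0.
  by rewrite -addrA ler_wpDr ?addr_ge0// /divides_coord z0 dvdz0.
have cz : (content z <= `|z ord0 ord0|)%N by exact: content_le.
have [big|small] := ltnP X (`|z ord0 ord0| ^ 2)%N.
  rewrite addrAC ler_wpDl ?addr_ge0// ler_pdivlMl ?ltr0n// mulr1.
  by rewrite /coord -real_normK ?num_real// -intr_norm -natr_absz -natrX ler_nat ltnW.
have c0 : (0 < content z)%N.
  by rewrite lt0n; apply: contra z0 => /eqP/content_eq0 ->; rewrite mxE.
have Mc : (M <= content z)%N by move: bad; rewrite -leqn0 leqNgt c0.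
have cX : (content z ^ 2 <= X)%N by rewrite (leq_trans _ small)// leq_exp2r.
have dvd c : divides_coord R c (content z) z = 1.
  by rewrite /divides_coord; have /dvdn_contentP -> := dvdnn (content z).
rewrite ler_wpDl ?addr_ge0// big_mkcond /= (bigD1_seq (content z)) ?iota_uniq//=; last first.
  rewrite mem_index_iota Mc ltnS (leq_trans _ cX)//.
  by rewrite -{1}[content z]expn1 leq_pexp2l.
rewrite cX !dvd mul1r lerDl; apply: sumr_ge0 => d _; case: ifP => // _; apply: mulr_ge0.
  by have /andP[] := divides_coord01 ord_max d z.
by have /andP[] := divides_coord01 ord0 d z.
Qed.

(** [J] is fixed first, to make the second moment term small; then [M] is taken large in terms of
    [J], and [n] in terms of [M]. *)
Lemma sphere_bad_content (e : R) : 0 < e -> \forall M \near \oo, \forall n \near \oo,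
  sphere_mean n (@bad_content R k M) <= e.
Proof.
move=> e0; have e4 : 0 < e / 4 by rewrite divr_gt0.
have [J0 _ J0P] := near_div_le 3 e4; pose J := J0.+1.
have J3 : 3 / J%:R <= e / 4 by exact: J0P (leqnSn _).
pose D : R := (2 + 4 * C * J%:R) ^+ 2 + 2 * C * J%:R ^+ 2.
have D0 : 0 <= D by rewrite addr_ge0 ?sqr_ge0// mulr_ge0 ?sqr_ge0// mulr_ge0.
apply: filterS3 (nbhs_infty_gt 0) (near_div_le 2 e4) (near_div_le (D * 2) e4).
move=> M M0 M2 MD.
have C4 : 0 <= 4 * C by rewrite mulr_ge0.
apply: filterS3 (nbhs_infty_ge M) (nbhs_infty_gt 0) (near_div_sqrt_le C4 e4).
move=> n Mn n0 nC.
pose X := (J ^ 2 * n)%N.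
have X0 : (0 < X)%N by rewrite muln_gt0.
have mm := mean_sphere R k n.
apply: le_trans (mean_le mm (fun z => bad_content_le z M0 (ltn0Sn J0) n0)) _.
rewrite meanD// meanD// meanZ// mean_sum//.
have b1 := sphere_divides1 n0 M0.
have b2 : X%:R^-1 * sphere_mean n (fun z : V => coord R ord0 z ^+ 2) <= e / 4.
  apply: (le_trans _ J3); rewrite ler_pdivrMl ?ltr0n//.
  apply: le_trans (sphere_second_moment R ord0 n) _.
  rewrite mulrCA ler_wpM2l// ler_pdivlMr// -natrM ler_nat /X mulnC leq_mul2r.
  by rewrite -mulnn leq_pmulr ?orbT.
have b3 : \sum_(M <= d < X.+1 | (d ^ 2 <= X)%N)
    sphere_mean n (fun z => Q d z * P d z) <= e / 4.
  apply: (le_trans _ MD); rewrite -mulrA.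
  apply: (@le_trans _ _ (\sum_(M <= d < X.+1) D * d%:R ^- 2)); last first.
    rewrite -mulr_sumr ler_wpM2l// sum_inv_sqr_le// M0 leqW//.
    by rewrite (leq_trans Mn)// leq_pmull// expn_gt0.
  rewrite big_mkcond /= big_nat [leRHS]big_nat; apply: ler_sum => d /andP[Md _].
  have d0 : (0 < d)%N by exact: leq_trans Md.
  case: ifP => [dX|_]; last by rewrite mulr_ge0// invr_ge0 exprn_ge0.
  exact: sphere_divides2.
by have := b1; have := b2; have := b3; rewrite -/X; lra.
Qed.

End SphereTail.

(** * Half-sums over consecutive spheres *)

Section AnnularMean.
Variables (R : realType) (k : nat).
Local Notation K := k.+2.
Local Notation V := 'cV[int]_K.
Local Notation e0 := (delta_mx 0 0 : V).
Local Notation C := ((mixing_const k)%:R : R).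

Definition annular_mean n (g : V -> R) : R :=
  2^-1 * (sphere_mean n.-1 g + sphere_mean n g).

Lemma mean_annular n : mean (annular_mean n).
Proof. by apply: mean_half; exact: mean_sphere. Qed.

Lemma sphere_almost_invariant (x y : letter K) :
  almost_invariant (@sphere_mean R k) (lvec x - lvec y).
Proof.
move=> g g1; apply/cvgr0Pnorm_le => e e_gt0.
have e2 : 0 < e / 2 by rewrite divr_gt0.
have C0 : 0 <= C by [].
apply: filterS3 (nbhs_infty_gt 0) (near_div_le C e2) (near_div_sqrt_le C0 e2).
move=> n n0 nC nCs.
have := @sphere_mean_shift R k n x y g (fun=> 1) 1 n0 g1 erefl (fun=> lexx _).
rewrite (mean_cst (mean_sphere _ _ _)) !mulr1 => /le_trans; apply.
by rewrite [leRHS]splitr addrC lerD.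
Qed.

Lemma parity_lvec_sum (h : V -> R) z w : parity_function h ->
  h (z + lvec_sum w) = if odd (size w) then h (z + e0) else h z.
Proof.
move=> hp; elim: w z => [|x w IHw] z; first by rewrite /lvec_sum big_nil addr0.
rewrite lvec_sum_cons addrA IHw /=; case: (odd _) => /=.
  exact: (@parity_function2 _ _ _ _ x (0, false)).
exact: (hp z x (0, false)).
Qed.

Lemma sphere_mean_parity n (h : V -> R) : parity_function h ->
  sphere_mean n h = if odd n then h e0 else h 0.
Proof.
move=> hp; rewrite -[RHS](mean_cst (mean_sphere R k n)) /sphere_mean /average.
congr (_ / _); rewrite !big_map; apply: eq_big_seq => w.
rewrite mem_reduced_words => /andP[_ /eqP <-].
by rewrite -[lvec_sum w]add0r parity_lvec_sum// add0r.
Qed.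

(** The smeared function [h] is constant on each sphere, equal to [h 0] or [h e0] by the parity of
    the radius; two consecutive spheres give exactly [periodic_mean N g]. *)
Lemma annular_mean_cvg N (g : V -> R) : (0 < N)%N -> periodic N g ->
  (forall z, `|g z| <= 1) ->
  annular_mean n g @[n --> \oo] --> periodic_mean N g.
Proof.
move=> N0 gN g1; pose h := smears N (letter_diffs k) g.
have hp : parity_function h by exact: parity_smears.
have sh : sphere_mean n g - sphere_mean n h @[n --> \oo] --> 0.
  apply: mean_smears => //; first exact: mean_sphere.
  by move=> _ /allpairsP[[x y] /= [_ _ ->]]; exact: sphere_almost_invariant.
have cv : 2^-1 * ((sphere_mean n g - sphere_mean n h) +
    (sphere_mean n.+1 g - sphere_mean n.+1 h)) + periodic_mean N g
    @[n --> \oo] --> periodic_mean N g.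
  rewrite -[X in _ --> X]add0r; apply: cvgD; last exact: cvg_cst.
  rewrite -[X in _ --> X](mulr0 2^-1); apply: cvgMl_tmp.
  rewrite -[X in _ --> X]addr0; apply: cvgD => //.
  by rewrite (cvg_shiftS (fun n => sphere_mean n g - sphere_mean n h)).
suff E : (fun n => annular_mean n.+1 g) = (fun n => 2^-1 *
    ((sphere_mean n g - sphere_mean n h) + (sphere_mean n.+1 g - sphere_mean n.+1 h))
    + periodic_mean N g) by rewrite -cvg_shiftS E.
apply/funext => n; rewrite /annular_mean /periodic_mean -/h /= !(sphere_mean_parity _ hp) /=.
by case: (odd n) => /=; ring.
Qed.

Lemma annular_bad_content (e : R) : 0 < e -> \forall M \near \oo, \forall n \near \oo,
  annular_mean n (@bad_content R k M) <= e.
Proof.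
move=> e_gt0; apply: filterS (sphere_bad_content k e_gt0) => M [n0 _ H].
exists n0.+1 => // n /= n0n; rewrite /annular_mean.
have h1 : sphere_mean n.-1 (@bad_content R k M) <= e by apply: H => /=; lia.
have h2 : sphere_mean n (@bad_content R k M) <= e by apply: H => /=; lia.
by lra.
Qed.

End AnnularMean.

(** * The two densities *)

Lemma ncardE (T : choiceType) (A : set T) (s : seq T) :
  uniq s -> (forall x, A x <-> x \in s) -> ncard A = size s.
Proof.
move=> us As; have -> : A = [set` s] by apply/seteqP; split=> x /As.
rewrite /ncard; have -> : fset_set [set` s] = [fset x in s]%fset.
  apply/fsetP => x; rewrite in_fset_set; last exact: finite_seq.
  by rewrite inE; apply/idP/idP; rewrite inE.
by rewrite card_fseq undup_id.
Qed.

Lemma ncard_pred (T : choiceType) (A : set T) (P : pred T) (s : seq T) :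
  uniq s -> (forall x, P x = (x \in s)) ->
  ncard [set x | A x /\ P x] = count (fun x => `[< A x >]) s.
Proof.
move=> us Ps; rewrite -size_filter; apply: ncardE; first by rewrite filter_uniq.
by move=> x; rewrite mem_filter -Ps; split=> [[/asboolP -> ->]|/andP[/asboolP]].
Qed.

Lemma powRK (R : realType) (r x : R) : 0 < r -> 0 <= x -> (x `^ r) `^ r^-1 = x.
Proof. by move=> r0 x0; rewrite -powRrM divff ?lt0r_neq0// powRr1. Qed.

Section LpBalls.
Variables (R : realType) (k : nat) (p : \bar R).
Local Notation K := k.+2.
Local Notation V := 'cV[int]_K.
Hypothesis p1 : (1 <= p)%E.

Definition lp_ball n : pred V := fun z => lp_norm p z <= n%:R.

Lemma abs_coord (z : V) i : `|(z i 0)%:~R| = (absz (z i ord0))%:R :> R.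
Proof. by rewrite -intr_norm -natr_absz. Qed.

Lemma sum_powR_ge0 r (z : V) : 0 <= \sum_(i < K) `|(z i 0)%:~R| `^ r :> R.
Proof. by apply: sumr_ge0 => i _; exact: powR_ge0. Qed.

Lemma lp_ball_solid n (y z : V) :
  (forall i, `|y i ord0| <= `|z i ord0|)%N -> lp_ball n z -> lp_ball n y.
Proof.
move=> yz; rewrite /lp_ball; apply: le_trans.
case: p p1 => [r||] //=; last 1 first.
- move=> _; apply/bigmax_leP; split=> [|i _].
    by apply: (le_trans _ (le_bigmax _ _ ord0)).
  by apply: le_trans (le_bigmax _ _ i); rewrite !abs_coord ler_nat.
rewrite lee_fin => r1; have r0 : 0 <= r by apply: le_trans r1.
apply: ge0_ler_powR; rewrite ?nnegrE ?invr_ge0 ?sum_powR_ge0//.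
apply: ler_sum => i _; apply: ge0_ler_powR; rewrite ?nnegrE//.
by rewrite !abs_coord ler_nat.
Qed.

Lemma lp_ball_cube n (z : V) : lp_ball n z -> forall i, (`|z i ord0| <= n)%N.
Proof.
rewrite /lp_ball => zn i; rewrite -(ler_nat R) -abs_coord; apply: le_trans zn.
case: p p1 => [r||] //=; last by move=> _; exact: le_bigmax.
rewrite lee_fin => r1; have r0 : 0 < r by apply: lt_le_trans r1.
rewrite -[leLHS](powRK r0)//.
apply: ge0_ler_powR; rewrite ?nnegrE ?invr_ge0 ?powR_ge0 ?(ltW r0) ?sum_powR_ge0//.
rewrite (bigD1 i)//= ler_wpDr//; apply: sumr_ge0 => j _; exact: powR_ge0.
Qed.

Lemma cube_lp_ball n (z : V) : (forall i, `|z i ord0| * K <= n)%N -> lp_ball n z.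
Proof.
move=> zn; rewrite /lp_ball; have K1 : 1 <= K%:R :> R by rewrite ler1n.
have K0 : 0 < K%:R :> R by rewrite ltr0n.
case: p p1 => [r||] //=; last first.
  move=> _; apply/bigmax_leP; split=> // i _; rewrite abs_coord ler_nat.
  by rewrite (leq_trans _ (zn i))// leq_pmulr.
rewrite lee_fin => r1; have r0 : 0 < r by apply: lt_le_trans r1.
rewrite -[leRHS](powRK r0)//.
apply: ge0_ler_powR; rewrite ?nnegrE ?invr_ge0 ?powR_ge0 ?(ltW r0) ?sum_powR_ge0//.
have nK : n%:R = K%:R * (n%:R / K%:R) :> R by rewrite mulrC divfK ?gt_eqF.
rewrite nK powRM ?divr_ge0//.
apply: (@le_trans _ _ (\sum_(i < K) (n%:R / K%:R) `^ r)).
  apply: ler_sum => i _; apply: ge0_ler_powR; rewrite ?nnegrE ?(ltW r0) ?divr_ge0//.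
  by rewrite abs_coord ler_pdivlMr// -natrM ler_nat.
(* It remains to see that [K] is at most its [r]-th power, where [1 <= r] enters. *)
rewrite sumr_const card_ord -[leLHS]mulr_natl ler_wpM2r ?powR_ge0//.
by rewrite -[leLHS]powRr1// ler_powR.
Qed.

Lemma ball_ratioE (S : set V) n :
  ball_ratio p S n = average (ball_seq lp_ball n) (indicator R S).
Proof.
have mem z : lp_ball n z = (z \in ball_seq lp_ball n).
  by rewrite (mem_ball_seq lp_ball_cube).
rewrite /ball_ratio /average /indicator sum_pred_natr.
rewrite (ncard_pred S (ball_seq_uniq lp_ball n) mem).
by rewrite (@ncardE _ _ _ (ball_seq_uniq lp_ball n))// => z; rewrite -mem.
Qed.

Lemma ball_ratio_cvg (S : set V) : SL_invariant S ->
  ball_ratio p S n @[n --> \oo]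
    --> limn (fun M => periodic_mean M`! (content_approx R S M)).
Proof.
move=> SL; have meanB n : mean (average (R := R) (ball_seq lp_ball n)).
  apply: mean_average; apply: size_ball_seq_gt0.
    exact: lp_ball_cube.
  exact: cube_lp_ball.
have -> : ball_ratio p S = fun n => average (ball_seq lp_ball n) (indicator R S).
  by apply/funext => n; exact: ball_ratioE.
apply: (SL_density (m := fun n => average (ball_seq lp_ball n))) => //.
- move=> N g N0 gN g1.
  apply: (@periodic_mean_cvg R k (fun n => average (ball_seq lp_ball n))) => // x.
  exact: (almost_invariant_ball lp_ball_solid lp_ball_cube cube_lp_ball).
- by move=> e e0; exact: (ball_bad_content lp_ball_cube cube_lp_ball).
Qed.

End LpBalls.

Section AnnularRatio.
Variables (R : realType) (k : nat) (F : groupType) (a : 'I_k.+2 -> F).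
Local Notation K := k.+2.
Local Notation V := 'cV[int]_K.
Variable alpha : F -> V.
Hypothesis ha : free_basis a.
Hypothesis alphaM : {morph alpha : x y / (x * y)%g >-> x + y}.
Hypothesis alpha_basis : forall i, alpha (a i) = delta_mx i 0.

Lemma alpha_word_value w : alpha (word_value a w) = lvec_sum w.
Proof.
have alpha1 : alpha 1%g = 0.
  by apply: (addrI (alpha 1%g)); rewrite -alphaM mulg1 addr0.
elim: w => [|x w IHw]; first by rewrite /word_value /lvec_sum !big_nil.
rewrite word_value_cons alphaM IHw lvec_sum_cons; congr (_ + _).
case: x => i [] /=; rewrite /lvec /= -alpha_basis//.
by apply: (addrI (alpha (a i))); rewrite -alphaM mulgV alpha1 subrr.
Qed.

(** Evaluation is a bijection from the reduced words of length [n] onto the sphere. *)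
Lemma gammaE n (S : set V) :
  gamma a n (alpha @^-1` S) =
  count (fun w => `[< S (lvec_sum w) >]) (reduced_words k n).
Proof.
rewrite -size_filter -(size_map (word_value a)); apply: ncardE => [|x].
  rewrite map_inj_in_uniq ?filter_uniq ?reduced_words_uniq// => s t.
  rewrite !mem_filter !mem_reduced_words => /and3P[_ sred _] /and3P[_ tred _].
  exact: word_value_inj.
split=> [[Sx <-]|/mapP[s + ->]]; last first.
  rewrite mem_filter mem_reduced_words => /and3P[/asboolP Ss sred /eqP sn].
  by rewrite /= alpha_word_value word_length_value.
have [s sred xE] := reduced_word_value_surj ha x.
apply/mapP; exists s => //; rewrite mem_filter mem_reduced_words sred.
rewrite -xE word_length_value// eqxx !andbT; apply/asboolP.
by move: Sx; rewrite -xE /= alpha_word_value.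
Qed.

Lemma annular_ratioE (S : set V) n :
  annular_ratio R a (alpha @^-1` S) n = annular_mean n (indicator R S).
Proof.
have ratioE j : (gamma a j (alpha @^-1` S))%:R / (gamma a j setT)%:R =
    sphere_mean j (indicator R S).
  rewrite -(preimage_setT alpha) !gammaE /sphere_mean /average size_map big_map.
  rewrite /indicator sum_pred_natr; congr (_ / _%:R).
  by apply/eqP; rewrite -all_count; apply/allP => w _; apply/asboolP.
by rewrite /annular_ratio !ratioE.
Qed.

Lemma annular_ratio_cvg (S : set V) : SL_invariant S ->
  annular_ratio R a (alpha @^-1` S) n @[n --> \oo]
    --> limn (fun M => periodic_mean M`! (content_approx R S M)).
Proof.
move=> SL.
have -> : annular_ratio R a (alpha @^-1` S) = fun n => annular_mean n (indicator R S).
  by apply/funext => n; exact: annular_ratioE.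
apply: SL_density => //.
- exact: mean_annular.
- exact: annular_mean_cvg.
- exact: annular_bad_content.
Qed.

End AnnularRatio.

Theorem theorem1 (R : realType) (k : nat) (hk : (2 <= k)%N)
    (F : groupType) (a : 'I_k -> F) (ha : free_basis a)
    (alpha : F -> 'cV[int]_k)
    (alphaM : {morph alpha : x y / (x * y)%g >-> x + y})
    (alpha_basis : forall i, alpha (a i) = delta_mx i 0)
    (S : set 'cV[int]_k) (hS : SL_invariant S) :
  (forall p : \bar R, (1 <= p)%E ->
     cvgn (ball_ratio p S)
     /\ strict_asymptotic_density p S = strict_asymptotic_density +oo%E S)
  /\
  (cvgn (annular_ratio R a (alpha @^-1` S))
   /\ strict_annular_density R a (alpha @^-1` S)
      = strict_asymptotic_density +oo%E S).
Proof.
case: k hk a ha alpha alphaM alpha_basis S hS => [//|[//|k]] _.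
move=> a ha alpha alphaM alpha_basis S hS.
have ball p (p1 : (1 <= p)%E) := @ball_ratio_cvg R k p p1 S hS.
have annular := @annular_ratio_cvg R k F a alpha ha alphaM alpha_basis S hS.
(* This limit does not depend on [p], and it is also the limit of the annular ratios. *)
have densityE p : (1 <= p)%E -> strict_asymptotic_density p S =
    limn (fun M => periodic_mean M`! (content_approx R S M)).
  by move=> p1; apply: cvg_lim => //; exact: ball.
split=> [p p1|]; split; rewrite ?densityE// ?leey//.
- by apply/cvg_ex; eexists; exact: ball.
- by apply/cvg_ex; eexists; exact: annular.
- exact: cvg_lim annular.
Qed.
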